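(* Let $0<p<1$ and $\alpha\in(0,1]$, and let $m=m_n\le n$ be positive integers such that $m,n\to\infty$ and $m/n\to\alpha$. Let $S_j=\sum_{k=1}^jX_k$, $j\le n$, be the positions of the elephant random walk with parameter $p$ and memory restricted to the first $m_n$ steps. Then, as $n\to\infty$: (a) If $0<p<3/4$, then $$E\Big(\frac{S_n\sqrt m}{n}\Big)=E\Big(\frac{S_m}{\sqrt m}\Big)\cdot\big((2p-1)+2\alpha(1-p)\big)+o(1)\to0,$$ $$\operatorname{Var}\Big(\frac{S_n\sqrt m}{n}\Big)=\frac{1}{3-4p}\cdot\big((2p-1)^2(1-\alpha)^2+2(2p-1)\alpha(1-\alpha)+\alpha^2\big)+\alpha(1-\alpha)+o(1)$$ $$=\frac{1}{3-4p}\cdot\big((2p-1)(1-\alpha)+\alpha\big)^2+\alpha(1-\alpha)+o(1).$$ If, in particular, $p=1/2$, then $\operatorname{Var}\big(\frac{S_n\sqrt m}{n}\big)\to\alpha$, or, equivalently, $\operatorname{Var}\big(\frac{S_n}{\sqrt n}\big)\to1$. (b) If $p=3/4$, then $$E\Big(\frac{S_n\sqrt{m/\log m}}{n}\Big)=E\Big(\frac{S_m}{\sqrt{m\log m}}\Big)\cdot\frac{1+\alpha}{2}+o(1)\to0,$$ $$\operatorname{Var}\Big(\frac{S_n\sqrt{m/\log m}}{n}\Big)=\operatorname{Var}\Big(\frac{S_m}{\sqrt{m\log m}}\Big)\cdot\Big(\frac14(1-\alpha)^2+\alpha\Big)+o(1)=\frac14(1-\alpha)^2+\alpha+o(1).$$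 (c) If $3/4<p<1$, then $$E\Big(\frac{S_n\,m^{2(1-p)}}{n}\Big)=E\Big(\frac{S_m}{m^{2(1-p)}}\Big)\cdot\big((2p-1)+2\alpha(1-p)+o(1)\big)\to0,$$ $$\operatorname{Var}\Big(\frac{S_n\,m^{2(1-p)}}{n}\Big)=\operatorname{Var}(L)\cdot\big((2p-1)^2(1-\alpha)^2+2(2p-1)\alpha(1-\alpha)+\alpha^2\big)+o(1)$$ $$=\operatorname{Var}(L)\cdot\big((2p-1)(1-\alpha)+\alpha\big)^2+o(1),$$ where $L$ is the almost sure limit of $\widetilde S_j/j^{2p-1}$ as $j\to\infty$ for the full-memory elephant random walk $(\widetilde S_j)_{j\ge1}$ with the same parameter $p$.
   Context: Full-memory elephant random walk (ERW) with parameter $p$: $\widetilde X_1=1$ with probability $p$ and $\widetilde X_1=-1$ with probability $1-p$. Given $\widetilde X_1,\dots,\widetilde X_k$, one sets $\widetilde X_{k+1}=+\widetilde X_K$ with probability $p$ and $\widetilde X_{k+1}=-\widetilde X_K$ with probability $1-p$, where $K$ is uniform on $\{1,\dots,k\}$, and the choices of $K$ and of the sign are independent of each other and of the past. Put $\widetilde S_j=\sum_{k=1}^j\widetilde X_k$. For $3/4<p<1$ it is known that $\widetilde S_j/j^{2p-1}$ converges almost surely to a random variable denoted $L$, that $\operatorname{Var}(\widetilde S_j/j^{2p-1})\to\operatorname{Var}(L)$, and that $$E(L)=\frac{2p-1}{\Gamma(2p)},\qquad \operatorname{Var}(L)=\frac{1}{(4p-3)\Gamma(2(2p-1))}-\frac{(2p-1)^2}{\Gamma^2(2p)}.$$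 ERW with memory restricted to the first $m_n$ steps (triangular scheme): for each $n$, with $m=m_n$, the steps $X_1,\dots,X_n$ (depending on $n$, the index being suppressed) are defined as follows. $X_1,\dots,X_m$ are the first $m$ steps of a full-memory ERW with parameter $p$. For $m\le k<n$, given $X_1,\dots,X_k$, $X_{k+1}=+X_K$ with probability $p$ and $-X_K$ with probability $1-p$, where $K$ is uniform on $\{1,\dots,m\}$, and $K$ and the sign are independent of each other and of the past.
   Formalization: In (c) the printed mean claim fails for all 3/4<p<1: E(S_n m^{2(1-p)}/n) has a positive limit. Proved instead: it equals E(S_m/m^{2p-1})·((2p-1)+2α(1-p)+o(1)) and tends to E(L)·((2p-1)+2α(1-p)), not 0. *)

(* Defs.v *)
From HB Require Import structures.
From mathcomp Require Import all_boot all_order all_algebra.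
From mathcomp Require Import all_classical all_reals all_analysis.

Set Implicit Arguments.
Unset Strict Implicit.
Unset Printing Implicit Defensive.

Import Order.TTheory GRing.Theory Num.Theory.
Import numFieldNormedType.Exports.

Local Open Scope classical_set_scope.
Local Open Scope ring_scope.

Section elephant_random_walk.
Context d (T : measurableType d) (R : realType) (P : probability T R).

(* Sequences of steps are indexed from 1: [X k] is the k-th step, and the value
   of [X 0] is never used. *)
Implicit Types (X : nat -> {RV P >-> R}) (p : R) (k r m n j : nat).

Definition sign_law p (e : {RV P >-> R}) : Prop :=
  P (e @^-1` [set 1]) = p%:E /\ P (e @^-1` [set -1]) = (1 - p)%:E.

Definition uniform_upto r (K : {RV P >-> nat}) : Prop :=
  forall i, (1 <= i <= r)%N -> P (K @^-1` [set i]) = (r%:R^-1)%:E.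

Definition past k X (x : nat -> R) : set T :=
  [set t | forall j, (1 <= j <= k)%N -> X j t = x j].

(* Mutual independence of (X 1, ..., X k), K and e. All the variables to which
   this is applied are almost surely finitely valued, so that the product rule
   for point masses is independence of the generated sigma-algebras. *)
Definition independent_of_past k X (K : {RV P >-> nat}) (e : {RV P >-> R}) :
    Prop :=
  forall (x : nat -> R) (i : nat) (s : R),
    P (past k X x `&` (K @^-1` [set i]) `&` (e @^-1` [set s])) =
    (P (past k X x) * P (K @^-1` [set i]) * P (e @^-1` [set s]))%E.

(* The step k+1 repeats (with probability p) or reverses (with probability
   1 - p) a step chosen uniformly among the first r ones. *)
Definition erw_step p k r X : Prop :=
  exists (K : {RV P >-> nat}) (e : {RV P >-> R}),
    [/\ uniform_upto r K, sign_law p e, independent_of_past k X K e &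
        forall t, X k.+1 t = e t * X (K t) t].

Definition full_erw p X : Prop :=
  sign_law p (X 1) /\ forall k, (1 <= k)%N -> erw_step p k k X.

(* Only X 1, ..., X n are constrained. *)
Definition restricted_erw p m n X : Prop :=
  [/\ sign_law p (X 1),
      forall k, (1 <= k < m)%N -> erw_step p k k X &
      forall k, (m <= k < n)%N -> erw_step p k m X].

Definition walk X j : T -> R := fun t => \sum_(1 <= k < j.+1) X k t.

End elephant_random_walk.

(* u_n = v_n + o(1); the error term is real-valued, so this also says that
   infinite values of u and v agree for large n. *)
Definition eq_o1 (R : realType) (u v : nat -> \bar R) : Prop :=
  exists2 r : nat -> R, r @ \oo --> (0 : R) &
    \forall n \near \oo, u n = (v n + (r n)%:E)%E.

(* Main.v *)
Require Import Defs.
From HB Require Import structures.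
From mathcomp Require Import all_boot all_order all_algebra.
From mathcomp Require Import all_classical all_reals all_analysis.
From mathcomp Require Import measurable_realfun.
From mathcomp Require Import ring lra.

(** Write a = 2p - 1, rho = m / n and kappa = a (1 - rho) + rho, and let the
    final position be multiplied by g / n, where g = g(m) is the normalization
    of the case at hand.

    Everything follows from one identity: a new step which repeats or reverses
    a uniform element of X_1, ..., X_r has, against any function G of the past,
    the same mean as a S_r / r ([erw_step_mean]). Taking for G a constant or a
    position of the walk gives recurrences for means and second moments. As
    long as the memory is full they read

      E S_(k+1) = (1 + a / k) E S_k,   E S_(k+1)^2 = (1 + 2 a / k) E S_k^2 + 1,

    so E S_k is a times [growth a k] = prod_(0 < j < k) (1 + a / j) and E S_k^2
    is [square_moment (2 a) k]. Once the memory is frozen at m the recurrences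
    are affine with constant increments, and they solve to the exact formulas

      E (S_n g / n) = kappa E (S_m g / m),
      Var (S_n g / n) = kappa^2 Var (S_m g / m)
          + rho (1 - rho) (g^2 / m) (1 - a^2 E S_m^2 / m^2).

    As rho tends to alpha, all three cases reduce to the limits of
    E (S_m g / m), E (S_m g / m)^2 and g^2 / m. These are deterministic:
    [growth c k] has order k^c, because the harmonic sums differ from ln by a
    bounded amount, and the recurrence for second moments has the closed forms
    (k - c growth c k) / (1 - c) for c <> 1 and k (1 + 1/2 + ... + 1/k) for
    c = 1, where c = 2 a. The cases c < 1, c = 1 and c > 1 are (a), (b) and (c).

    Case (c) also asks for the first two moments of the almost sure limit L.
    With full memory, M_k = S_k / growth a k is a martingale, and E M_k^2 is
    nondecreasing and, for c > 1, bounded, with some limit q. Since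
    E (M_j - M_k)^2 = E M_k^2 - E M_j^2 for j <= k, the lemma of Fatou bounds
    the square distance from M_j to the almost sure limit by q - E M_j^2.
    Hence M_j converges in L^2 as well, and the mean and the second moment of
    the limit are a and q ([martingale_limit_moments]). As growth a k / k^a
    converges to some l > 0, the mean and variance of L are l a and
    l^2 (q - a^2), and these are also the limits of the mean and variance of
    S_m / m^a. *)

Set Implicit Arguments.
Unset Strict Implicit.
Unset Printing Implicit Defensive.

Import Order.TTheory GRing.Theory Num.Theory.
Import numFieldNormedType.Exports.

Local Open Scope classical_set_scope.
Local Open Scope ereal_scope.
Local Open Scope ring_scope.

(** * Asymptotics of the products and of the second moments *)

Section growth.
Variable R : realType.
Implicit Types (c s : R) (k n : nat).

(** The quotient Gamma (k + c) / (Gamma k * Gamma (1 + c)). *)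
Definition growth c k : R := \prod_(1 <= j < k) (1 + c / j%:R).

Lemma growth1 c : growth c 1 = 1.
Proof. by rewrite /growth big_geq. Qed.

Lemma growthS c k : (0 < k)%N ->
  growth c k.+1 = growth c k * (1 + c / k%:R).
Proof. by move=> k0; rewrite /growth big_nat_recr. Qed.

Lemma growth_gt0 c k : 0 <= c -> 0 < growth c k.
Proof.
move=> c0; apply: prodr_gt0 => j _.
by rewrite ltr_pwDl// divr_ge0.
Qed.

Lemma ler_growthS c k : 0 <= c -> growth c k <= growth c k.+1.
Proof.
move=> c0; have [->|k0] := posnP k; first by rewrite /growth !big_geq.
by rewrite growthS// ler_peMr ?(ltW (growth_gt0 _ _))// lerDl divr_ge0.
Qed.

Definition harmonic_sum k : R := \sum_(1 <= j < k) j%:R^-1.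

Lemma harmonic_sumS k : (0 < k)%N -> harmonic_sum k.+1 = harmonic_sum k + k%:R^-1.
Proof. by move=> k0; rewrite /harmonic_sum big_nat_recr. Qed.

Lemma ln_le_harmonic_sum k : (0 < k)%N -> ln k%:R <= harmonic_sum k.
Proof.
elim: k => // -[_ _|k IH _]; first by rewrite ln1 /harmonic_sum big_geq.
rewrite harmonic_sumS//; apply: (@le_trans _ _ (ln k.+1%:R + k.+1%:R^-1)); last first.
  by rewrite lerD2r IH.
have -> : k.+2%:R = k.+1%:R * (1 + k.+1%:R^-1) :> R.
  by rewrite mulrDr mulr1 divff ?pnatr_eq0// -[k.+2]addn1 natrD.
rewrite lnM ?posrE// ?ltr_wpDr//.
rewrite lerD2l le_ln1Dx// (lt_le_trans (ltrN10 _))//.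
Qed.

(** Inductively, 1 / (k + 1) <= ln (k + 1) - ln k since ln (1 + x) <= x at
    x = - 1 / (k + 1). *)
Lemma harmonic_sum_le k : (0 < k)%N -> harmonic_sum k.+1 <= 1 + ln k%:R.
Proof.
elim: k => // -[_ _|k IH _].
  by rewrite harmonic_sumS// /harmonic_sum big_geq// ln1 invr1 add0r addr0.
rewrite harmonic_sumS//; apply: (le_trans (lerD (IH isT) (lexx _))).
rewrite -addrA lerD2l -lerBrDl.
have e : k.+1%:R = k.+2%:R * (1 + - k.+2%:R^-1) :> R.
  by rewrite mulrDr mulr1 mulrN divff ?pnatr_eq0// -[k.+2]addn1 natrD addrK.
have h : 0 < 1 + - k.+2%:R^-1 :> R.
  by rewrite subr_gt0 invf_lt1// ltr1n.
have -> : ln k.+1%:R = ln k.+2%:R + ln (1 + - k.+2%:R^-1) :> R.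
  by rewrite {1}e lnM ?posrE.
rewrite opprD addrA subrr add0r lerNr le_ln1Dx//.
by rewrite -subr_gt0 opprK addrC.
Qed.

(** Bound each factor by exp (c / j) and the harmonic sum by 1 + ln k. *)
Lemma growth_le c k : 0 <= c -> (0 < k)%N ->
  growth c k <= expR c * k%:R `^ c.
Proof.
move=> c0 k0; apply: (le_trans (ler_growthS k c0)).
rewrite /powR pnatr_eq0 (gtn_eqF k0) -expRD.
apply: (@le_trans _ _ (expR (c * harmonic_sum k.+1))); last first.
  by rewrite ler_expR -[leRHS](addrC) -[X in _ + X]mulr1 -mulrDr ler_wpM2l// addrC harmonic_sum_le.
rewrite /harmonic_sum big_distrr/= expR_sum /growth.
apply: ler_prod => j _.
by rewrite expR_ge1Dx andbT addr_ge0// divr_ge0.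
Qed.

(** For negative c only the first factor 1 + c may be negative, and from
    - 2 <= c on every factor has absolute value at most 1. *)
Lemma norm_growth_le c k : - 2 <= c ->
  `|growth c k| <= growth (Num.max c 0) k.
Proof.
move=> c2; rewrite /growth normr_prod big_nat_cond [leRHS]big_nat_cond.
apply: ler_prod => j /andP[/andP[j0 _] _].
rewrite normr_ge0/=.
have j1 : 0 < j%:R^-1 :> R by rewrite invr_gt0 ltr0n.
have j2 : j%:R^-1 <= 1 :> R by rewrite invf_le1 ?ler1n ?ltr0n.
have [c0|c0] := leP 0 c.
  by rewrite ger0_norm// addr_ge0// mulr_ge0// ltW.
rewrite mul0r addr0 ler_norml; apply/andP; split; nra.
Qed.

Lemma cvgy_ln_natr : (fun n => ln n%:R : R) @ \oo --> +oo.
Proof.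
apply/cvgryPgt => A.
have /cvgryPgt/(_ (expR A)) := @cvgr_idn R.
apply: filterS => n An.
by rewrite -(expRK A) ltr_ln ?posrE ?expR_gt0 ?(lt_trans (expR_gt0 A)).
Qed.

Lemma cvg_invn : (fun n => n%:R^-1 : R) @ \oo --> (0 : R).
Proof.
apply/cvgrVy.
  by near=> n; rewrite invr_gt0 ltr0n; near: n; exact: nbhs_infty_gt.
apply: cvg_trans (@cvgr_idn R); apply: near_eq_cvg.
by apply: nearW => n /=; rewrite invrK.
Unshelve. all: by end_near. Qed.

Lemma cvg_ln_inv : (fun k => (ln k%:R)^-1) @ \oo --> (0 : R).
Proof.
apply/cvgrVy.
  have /cvgryPgt/(_ 0) := cvgy_ln_natr.
  by apply: filterS => n; rewrite invr_gt0.
apply: cvg_trans cvgy_ln_natr; apply: near_eq_cvg.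
by apply: nearW => n /=; rewrite invrK.
Qed.

Lemma natr_powRE s n : (0 < n)%N -> n%:R `^ s = expR (s * ln n%:R) :> R.
Proof. by move=> n0; rewrite /powR pnatr_eq0 (gtn_eqF n0). Qed.

Lemma cvg_natr_powRN s : 0 < s ->
  (fun n => n%:R `^ (- s) : R) @ \oo --> (0 : R).
Proof.
move=> s0.
apply/cvgrVy.
  near=> n; rewrite powR_gt0// ltr0n; near: n.
  exact: nbhs_infty_gt.
apply/cvgryPgt => A; near=> n.
rewrite /= powRN invrK.
rewrite natr_powRE; last by near: n; exact: nbhs_infty_gt.
apply: lt_le_trans (expR_ge1Dx _); rewrite -ltrBlDl -ltr_pdivrMl//.
near: n; have /cvgryPgt := cvgy_ln_natr; exact.
Unshelve. all: by end_near. Qed.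

Lemma squeeze_norm0 (f g : nat -> R) :
  (\forall n \near \oo, `|f n| <= g n) -> g @ \oo --> (0 : R) ->
  f @ \oo --> (0 : R).
Proof.
move=> fg g0; apply: norm_cvg0.
apply: (@squeeze_cvgr _ _ _ _ (fun=> 0) g); [|exact: cvg_cst|exact: g0].
by apply: filterS fg => n ->; rewrite normr_ge0.
Qed.

Lemma cvg_growth_powR0 c s : - 2 <= c -> c < s -> 0 < s ->
  (fun n => growth c n / n%:R `^ s) @ \oo --> (0 : R).
Proof.
move=> c2 cs s0; set e := Num.max c 0.
have es : 0 < s - e by rewrite subr_gt0 gt_max cs.
have e0 : 0 <= e by rewrite le_max lexx orbT.
apply: (@squeeze_norm0 _ (fun n => expR e * n%:R `^ (- (s - e)))); last first.
  by rewrite -(mulr0 (expR e)); apply: cvgMl_tmp; exact: cvg_natr_powRN.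
near=> n.
have n0 : (0 < n)%N by near: n; exact: nbhs_infty_gt.
rewrite normrM [`|_^-1|]ger0_norm ?invr_ge0 ?powR_ge0//.
rewrite ler_pdivrMr ?powR_gt0 ?ltr0n// -mulrA -powRD; last first.
  by rewrite pnatr_eq0 (gtn_eqF n0) implybT.
rewrite opprB subrK.
by rewrite (le_trans (norm_growth_le _ _))// growth_le.
Unshelve. all: by end_near. Qed.

(** Convexity of exp between 0 and ln (1 + x). *)
Lemma powR1D_le c x : 0 <= c <= 1 -> 0 <= x -> (1 + x) `^ c <= 1 + c * x.
Proof.
move=> /andP[c0 c1] x0.
have x1 : 0 < 1 + x by rewrite ltr_pwDl.
rewrite /powR gt_eqF//.
have := @convex_expR R (Itv01 c0 c1) (ln (1 + x)) 0.
rewrite !convRE/= mulr0 addr0 expR0 mulr1 lnK ?posrE// => h.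
by apply: (le_trans h); rewrite /unstable.onem; lra.
Qed.

(** The ratio of consecutive terms is (1 + c / n) / (1 + 1 / n)^c, so this is
    Bernoulli's inequality [powR1D_le]. *)
Lemma growth_div_powR_nd c : 0 < c <= 1 ->
  {homo (fun n => growth c n / n%:R `^ c) : k n / (k <= n)%N >-> k <= n}.
Proof.
move=> /andP[c0 c1]; apply: homo_leq => // [x y z|n]; first exact: le_trans.
have [->|n0] := posnP n.
  by rewrite powR0 ?gt_eqF// invr0 mulr0 divr_ge0 ?powR_ge0 ?ltW ?growth_gt0 ?ltW.
rewrite growthS// -mulrA ler_pM2l; last by rewrite growth_gt0// ltW.
have p0 : 0 < n%:R `^ c :> R by rewrite powR_gt0// ltr0n.
have e : n.+1%:R = n%:R * (1 + n%:R^-1) :> R.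
  by rewrite mulrDr mulr1 divff ?pnatr_eq0 -?lt0n// -natr1.
rewrite e powRM// ?addr_ge0// invfM mulrCA ler_peMr ?invr_ge0 ?(ltW p0)//.
rewrite ler_pdivlMr ?powR_gt0 ?mul1r ?ltr_wpDr//.
by rewrite powR1D_le// c1 ltW.
Qed.

Lemma growth_ge c n : 0 < c <= 1 -> (0 < n)%N -> n%:R `^ c <= growth c n.
Proof.
move=> c01 n0.
have := growth_div_powR_nd c01 n0.
by rewrite growth1 powR1 div1r invr1 ler_pdivlMr ?powR_gt0 ?ltr0n// mul1r.
Qed.

(** By monotonicity and [growth_le]. The limit is 1 / Gamma (1 + c). *)
Lemma cvg_growth_div_powR c : 0 < c <= 1 ->
  exists2 l : R, 0 < l & (fun n => growth c n / n%:R `^ c) @ \oo --> l.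
Proof.
move=> /[dup] c01 /andP[c0 c1].
have : cvgn (fun n => growth c n / n%:R `^ c).
  apply: nondecreasing_is_cvgn; first exact: growth_div_powR_nd.
  exists (expR c) => _ [n _ <-].
  have [->|n0] := posnP n.
    by rewrite powR0 ?gt_eqF// invr0 mulr0 expR_ge0.
  by rewrite ler_pdivrMr ?powR_gt0 ?ltr0n// growth_le// ltW.
move=> h; exists (limn (fun n => growth c n / n%:R `^ c)) => //.
apply: (@lt_le_trans _ _ 1) => //; apply: limr_ge => //.
near=> n; rewrite ler_pdivlMr ?mul1r ?powR_gt0 ?ltr0n ?growth_ge//;
  near: n; exact: nbhs_infty_gt.
Unshelve. all: by end_near. Qed.

(** The second moment of the position of a full-memory walk after k steps,
    where c = 2 (2 p - 1). Starting from 0 cancels the meaningless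
    factor 1 + c / 0 and gives the value 1 after one step. *)
Fixpoint square_moment c k : R :=
  if k is j.+1 then (1 + c / j%:R) * square_moment c j + 1 else 0.

(** k / (1 - c) solves the recurrence and growth c solves its homogeneous
    part. *)
Lemma square_moment_neq1 c k : c != 1 -> (0 < k)%N ->
  square_moment c k = (k%:R - c * growth c k) / (1 - c).
Proof.
move=> c1; have c1' : 1 - c != 0 by rewrite subr_eq0 eq_sym.
elim: k => // -[_ _|k IH _].
  by rewrite /= mulr0 add0r growth1 mulr1 divff.
rewrite [LHS]/= -/(square_moment c k.+1) IH// (growthS c (ltn0Sn k)).
have : k.+1%:R != 0 :> R by rewrite pnatr_eq0.
rewrite -[k.+2]addn1 natrD; move: (k.+1%:R) (growth _ _) => x g x0.
by field; rewrite x0 c1'.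
Qed.

Lemma square_moment_1 k : square_moment 1 k = k%:R * harmonic_sum k.+1.
Proof.
elim: k => [|[|k] IH]; first by rewrite /= mul0r.
  by rewrite /= /harmonic_sum big_nat1 mulr0 add0r invr1 mulr1.
rewrite [LHS]/= -/(square_moment 1 k.+1) IH (harmonic_sumS (ltn0Sn k.+1)).
have : k.+1%:R != 0 :> R by rewrite pnatr_eq0.
have : k.+2%:R != 0 :> R by rewrite pnatr_eq0.
rewrite -[k.+2]addn1 natrD; move: (k.+1%:R) (harmonic_sum _) => x g x0 x1.
by field; rewrite x0 x1.
Qed.

Lemma cvg_square_moment_lt1 c : - 2 <= c < 1 ->
  (fun n => square_moment c n / n%:R) @ \oo --> ((1 - c)^-1 : R).
Proof.
move=> /andP[c2 c1].
have h : (fun n => (1 - c * (growth c n / n%:R `^ 1)) / (1 - c)) @ \oo -->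
    ((1 - c * 0) / (1 - c) : R).
  apply: cvgMr_tmp; apply: cvgB; first exact: cvg_cst.
  by apply: cvgMl_tmp; exact: cvg_growth_powR0.
rewrite mulr0 subr0 mul1r in h.
apply: cvg_trans h; apply: near_eq_cvg; near=> n.
have n0 : (0 < n)%N by near: n; exact: nbhs_infty_gt.
rewrite square_moment_neq1 ?lt_eqF// powRr1//.
have : n%:R != 0 :> R by rewrite pnatr_eq0 -lt0n.
have : 1 - c != 0 by rewrite subr_eq0 gt_eqF.
by move: (n%:R) (growth _ _) => x g ? ?; field; apply/andP.
Unshelve. all: by end_near. Qed.

Lemma cvg_square_moment_1 :
  (fun n => square_moment 1 n / (n%:R * ln n%:R)) @ \oo --> (1 : R).
Proof.
have h : (fun n => 1 + (ln n%:R)^-1) @ \oo --> (1 + 0 : R).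
  by apply: cvgD; [exact: cvg_cst|exact: cvg_ln_inv].
rewrite addr0 in h.
apply: (@squeeze_cvgr _ _ _ _ (fun=> 1) (fun n => 1 + (ln n%:R)^-1));
  [|exact: cvg_cst|exact: h].
near=> n.
have n0 : (0 < n)%N by near: n; exact: nbhs_infty_gt.
have ln0 : 0 < ln n%:R :> R by near: n; have /cvgryPgt := cvgy_ln_natr; exact.
rewrite square_moment_1 -mulf_div divff ?mul1r ?pnatr_eq0 -?lt0n//.
rewrite ler_pdivlMr// mul1r ler_pdivrMr// mulrDl mul1r mulVf ?gt_eqF//.
rewrite addrC (harmonic_sum_le n0) andbT harmonic_sumS//.
by rewrite (le_trans (ln_le_harmonic_sum n0))// lerDl invr_ge0.
Unshelve. all: by end_near. Qed.

(** For 2 c > 1 the homogeneous solution dominates: square moments are at most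
    a constant times k^(2 c), while (growth c k)^2 is at least k^(2 c). *)
Lemma square_moment_growth_bounded c : 1 / 2 < c <= 1 ->
  exists M : R, forall n, square_moment (2 * c) n / growth c n ^+ 2 <= M.
Proof.
move=> /andP[c2 c1]; have c0 : 0 < c by apply: lt_trans c2; lra.
exists (2 * c / (2 * c - 1) * expR (2 * c)) => n.
have d0 : 0 < 2 * c - 1 by lra.
have [->|n0] := posnP n.
  by rewrite mul0r mulr_ge0 ?expR_ge0// divr_ge0// ltW//; lra.
have p0 : 0 < n%:R `^ c :> R by rewrite powR_gt0// ltr0n.
rewrite ler_pdivrMr ?exprn_gt0 ?growth_gt0// ?(ltW c0)//.
apply: (@le_trans _ _ (2 * c / (2 * c - 1) * growth (2 * c) n)).
  rewrite square_moment_neq1 ?gt_eqF//; last by lra.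
  rewrite -(opprB (2 * c) 1) invrN mulrN -mulNr opprB [leRHS]mulrAC ler_pM2r ?invr_gt0//.
  by rewrite gerBl.
rewrite -[leRHS]mulrA ler_pM2l ?divr_gt0// ?mulr_gt0//.
apply: (@le_trans _ _ (expR (2 * c) * n%:R `^ (2 * c))).
  by rewrite growth_le// mulr_ge0// ltW.
rewrite ler_pM2l ?expR_gt0// mulrC powRrM powR_mulrn ?powR_ge0//.
by rewrite lerXn2r ?nnegrE ?(ltW p0)// ?(ltW (growth_gt0 _ (ltW c0)))// growth_ge// c0.
Qed.

End growth.

(** * Random variables of prescribed mean *)

Section has_mean.
Context d (T : measurableType d) (R : realType) (P : probability T R).
Implicit Types (f g h : T -> R) (v w b : R).

(** Integrability and the value of the expectation are carried together, so
    that the closure rules below never leave integrability side conditions. *)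
Definition has_mean f v := f \in Lfun P 1 /\ 'E_P[f]%E = v%:E.

Lemma has_mean_unique f v w : has_mean f v -> has_mean f w -> v = w.
Proof. by move=> [_ fv] [_]; rewrite fv => -[]. Qed.

Lemma has_mean_measurable f v : has_mean f v -> measurable_fun setT f.
Proof. by move=> [/Lfun1_integrable/measurable_int/measurable_EFinP]. Qed.

Lemma has_mean_ae f g v : measurable_fun setT g ->
  {ae P, forall t, g t = f t} -> has_mean f v -> has_mean g v.
Proof.
move=> mg gf fv; have mf := has_mean_measurable fv.
have fg : ae_eq P setT (EFin \o f) (EFin \o g).
  by apply: filterS gf => t /= ->.
case: fv => /Lfun1_integrable fi fv; split.
  apply/Lfun1_integrable/integrableP; split; first exact/measurable_EFinP.
  case/integrableP : fi => _; apply: le_lt_trans; rewrite le_eqVlt; apply/orP; left; apply/eqP.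
  apply: ae_eq_integral => //.
  - by apply: measurableT_comp => //; exact/measurable_EFinP.
  - by apply: measurableT_comp => //; exact/measurable_EFinP.
  - by apply: filterS gf => t /= ->.
rewrite -fv unlock; apply: ae_eq_integral => //; first exact/measurable_EFinP.
  exact/measurable_EFinP.
by apply: filterS gf => t /= ->.
Qed.

Lemma has_mean_eq f g v : g =1 f -> has_mean f v -> has_mean g v.
Proof. by move=> /funext ->. Qed.

Lemma has_mean_cst b : has_mean (cst b) b.
Proof. by split; [exact: Lfun_cst|exact: expectation_cst]. Qed.

Lemma has_meanD f g v w : has_mean f v -> has_mean g w ->
  has_mean (fun t => f t + g t) (v + w).
Proof.
move=> [fi fv] [gi gw]; split; first exact: rpredD.
by rewrite EFinD -fv -gw -expectationD.
Qed.

Lemma has_meanZ f v b : has_mean f v -> has_mean (fun t => b * f t) (b * v).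
Proof.
move=> [fi fv]; split; first exact: rpredZ.
rewrite EFinM -fv -expectationZl//; congr expectation; apply/funext => t /=.
exact: mulrC.
Qed.

Lemma has_mean_sum (I : finType) (V : pred I) (f : I -> T -> R) (v : I -> R) :
  (forall i, V i -> has_mean (f i) (v i)) ->
  has_mean (fun t => \sum_(i | V i) f i t) (\sum_(i | V i) v i).
Proof.
move=> fv; rewrite (_ : (fun t => _) = \sum_(i | V i) f i); last first.
  by apply/funext => t; rewrite fct_sumE.
elim/big_rec2 : _ => [|i w g /fv fi gw]; first exact: has_mean_cst.
exact: has_meanD.
Qed.

Lemma has_mean_indic A : measurable A -> has_mean \1_A (fine (P A)).
Proof.
move=> mA; split; last by rewrite expectation_indic// fineK// fin_num_measure.
by apply/Lfun1_integrable/integrable_indic.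
Qed.

(** A random variable that is almost surely constant on each piece of a finite
    almost sure partition is almost surely a simple function. *)
Lemma has_mean_partition (Q : finType) (V : pred Q) (B : Q -> set T)
    (c : Q -> R) h :
  measurable_fun setT h -> (forall q, V q -> measurable (B q)) ->
  {ae P, forall t, exists q, [/\ V q, B q t, h t = c q &
    forall q', V q' -> B q' t -> q' = q]} ->
  has_mean h (\sum_(q | V q) c q * fine (P (B q))).
Proof.
move=> mh mB hB.
apply: (@has_mean_ae (fun t => \sum_(q | V q) c q * \1_(B q) t)) => //.
  apply: filterS hB => t [q [Vq Bq -> uq]].
  rewrite (bigD1 q)//= indicE mem_set// mulr1 big1 ?addr0// => q' /andP[Vq' q'q].
  rewrite indicE memNset ?mulr0// => Bq'.
  by rewrite (uq _ Vq' Bq') eqxx in q'q.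
by apply: has_mean_sum => q Vq; apply: has_meanZ; apply: has_mean_indic; exact: mB.
Qed.

Lemma prob1_ae (A : set T) : measurable A -> P A = 1%E ->
  {ae P, forall t, A t}.
Proof.
move=> mA PA; exists (~` A); split => //; first exact: measurableC.
by rewrite probability_setC// PA subee.
Qed.

Lemma Lfun2_sqr f v : measurable_fun setT f ->
  has_mean (fun t => f t ^+ 2) v -> f \in Lfun P 2%:E.
Proof.
move=> mf [/Lfun1_integrable/integrableP[_ fi] _].
rewrite inE; apply/andP; split; rewrite inE//=.
rewrite /finite_norm unlock poweR_lty//.
apply: le_lt_trans fi; apply: ge0_le_integral => //.
- by move=> t _; rewrite lee_fin powR_ge0.
- apply/measurable_EFinP.
  apply: (@measurableT_comp _ _ _ _ _ _ (fun x : R => x `^ 2)) => //.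
  exact: measurableT_comp.
- by apply: measurableT_comp => //; apply/measurable_EFinP/measurable_funX.
- by move=> t _ /=; rewrite lee_fin normrX powR_mulrn.
Qed.

Lemma expectation_scale f v b : has_mean f v ->
  ('E_P[(fun t => f t * b)%R])%E = (v * b)%:E.
Proof.
move=> /(has_meanZ b)[_]; rewrite mulrC => <-; congr expectation.
by apply/funext => t; rewrite mulrC.
Qed.

Lemma variance_scale f v w b : measurable_fun setT f -> has_mean f v ->
  has_mean (fun t => f t ^+ 2) w ->
  ('V_P[(fun t => f t * b)%R])%E = ((w - v ^+ 2) * b ^+ 2)%:E.
Proof.
move=> mf fv fw; have f2 := Lfun2_sqr mf fw.
rewrite varianceE; last by apply: Lfun_scale => //; rewrite ler1n.
rewrite (expectation_scale b fv) (_ : _ ^+ 2 = fun t => f t ^+ 2 * b ^+ 2).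
  by rewrite (expectation_scale _ fw) -EFin_expe -EFinB; congr EFin; ring.
by apply/funext => t /=; rewrite -exprMn.
Qed.

End has_mean.

Lemma eq1N1 (R : numDomainType) : (1 == -1 :> R) = false.
Proof. by rewrite -subr_eq0 opprK (_ : 1 + 1 = 2%:R)// pnatr_eq0. Qed.

Section erw_step_mean.
Context d (T : measurableType d) (R : realType) (P : probability T R).
Variables (p : R).
Implicit Types (X : nat -> {RV P >-> R}) (k r m n j : nat) (w : R).

Lemma measurable_walk X j : measurable_fun setT (walk X j).
Proof. exact: measurable_sum. Qed.

Lemma walkS X j t : walk X j.+1 t = walk X j t + X j.+1 t.
Proof. by rewrite /walk big_nat_recr. Qed.

Lemma preimage_singleton_measurable (f : {RV P >-> R}) x :
  measurable (f @^-1` [set x]).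
Proof. exact: measurable_funPTI. Qed.

Lemma preimage_nat_measurable (K : {RV P >-> nat}) i :
  measurable (K @^-1` [set i]).
Proof. exact: measurable_funPTI. Qed.

Lemma sign_law_ae (e : {RV P >-> R}) : sign_law p e ->
  {ae P, forall t, e t = 1 \/ e t = -1}.
Proof.
move=> [e1 e2]; apply: (@prob1_ae _ _ _ _ (e @^-1` [set 1] `|` e @^-1` [set -1])).
  by apply: measurableU; exact: preimage_singleton_measurable.
rewrite measureU; [|exact: preimage_singleton_measurable..|].
  rewrite (_ : 1%E = (p%:E + (1 - p)%:E)%E); last by rewrite -EFinD addrC subrK.
  by congr (_ + _)%E.
by rewrite -subset0 => t [/= ->] /eqP; rewrite eq1N1.
Qed.

Lemma uniform_upto_ae r (K : {RV P >-> nat}) : (0 < r)%N ->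
  uniform_upto r K -> {ae P, forall t, (0 < K t <= r)%N}.
Proof.
move=> r0 uK.
have : {ae P, forall t, (\big[setU/set0]_(i < r) (K @^-1` [set i.+1])) t}.
  apply: prob1_ae.
    by apply: bigsetU_measurable => i _; exact: preimage_nat_measurable.
  rewrite measure_bigsetU_ord.
  - transitivity (\sum_(i < r) (r%:R^-1 : R)%:E)%E.
      by apply: eq_bigr => i _; apply: uK; rewrite /= ltn_ord.
    rewrite sumEFin sumr_const card_ord -[X in X%:E]mulr_natr mulVf ?pnatr_eq0 -?lt0n//.
  - by move=> i; exact: preimage_nat_measurable.
  - by move=> i j _ _ [t [/= -> []]] /esym/val_inj.
apply: filterS => t; rewrite -(@bigcup_mkord _ r (fun i => K @^-1` [set i.+1])).
by case=> i /= ir ->.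
Qed.

Lemma measurable_past k X x : measurable (past k X x).
Proof.
rewrite (_ : past k X x =
    \bigcap_(j in [set j | (1 <= j <= k)%N]) (X j @^-1` [set x j])).
  by apply: bigcap_measurableType => j _; exact: preimage_singleton_measurable.
by apply/seteqP; split.
Qed.

Definition signs k (o : {ffun 'I_k.+1 -> bool}) : nat -> R :=
  fun j => (-1) ^+ o (inord j).

(** The steps being almost surely 1 or -1, the past is determined by a sign
    vector. Coordinate 0, which corresponds to no step, is pinned down to make
    that vector unique. *)
Lemma past_signs_ae k X :
  (forall j, (1 <= j <= k)%N -> {ae P, forall t, X j t = 1 \/ X j t = -1}) ->
  {ae P, forall t, exists o : {ffun 'I_k.+1 -> bool},
    [/\ ~~ o ord0, past k X (signs o) t &
      forall o' : {ffun 'I_k.+1 -> bool}, ~~ o' ord0 -> past k X (signs o') t -> o' = o]}.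
Proof.
move=> X1.
have : {ae P, forall t, forall j, (1 <= j <= k)%N -> X j t = 1 \/ X j t = -1}.
  apply: ae_foralln => j.
  have [/X1|_] := boolP (1 <= j <= k)%N; first by apply: filterS.
  by apply: aeW => t.
(* true encodes the step -1. *)
apply: filterS => t Xt; exists [ffun i => (i != ord0) && (X i t == -1)].
split; first by rewrite ffunE eqxx.
- move=> j /[dup] jk /andP[j0 jk1]; rewrite /signs ffunE.
  have ij : (inord j : 'I_k.+1) = j :> nat by rewrite inordK.
  have ij0 : (inord j : 'I_k.+1) != ord0 by rewrite -val_eqE/= ij -lt0n.
  rewrite ij0 ij/=.
  by case: (Xt j jk) => ->; rewrite ?eqxx// eq1N1.
- move=> o' o'0 o't; apply/ffunP => i; rewrite ffunE.
  have [->|i0] := eqVneq i ord0; first exact/negbTE.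
  rewrite (o't i); last by rewrite lt0n -val_eqE in i0 *; rewrite i0 -ltnS ltn_ord.
  by rewrite /signs inord_val; case: (o' i); rewrite ?eqxx ?eq1N1.
Qed.

(** The past, the chosen index and the sign form an almost sure partition into
    finitely many pieces, and the product rule for point masses gives the
    probability of each of them. Summing over the sign yields p - (1 - p), and
    summing over the index yields S_r / r. *)
Lemma erw_step_mean k r X (G : (nat -> R) -> R) w :
  (0 < r <= k)%N -> erw_step p k r X ->
  (forall j, (1 <= j <= k)%N -> {ae P, forall t, X j t = 1 \/ X j t = -1}) ->
  (forall x y, (forall j, (1 <= j <= k)%N -> x j = y j) -> G x = G y) ->
  measurable_fun setT (fun t => G (X ^~ t)) ->
  has_mean P (fun t => G (X ^~ t) * walk X r t) w ->
  has_mean P (fun t => G (X ^~ t) * X k.+1 t) ((2 * p - 1) / r%:R * w).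
Proof.
move=> /andP[r0 rk] [K [e [uK se ind Xk]]] X1 GE mG Gw.
have pae := past_signs_ae X1.
pose O : finType := {ffun 'I_k.+1 -> bool}.
pose pr (o : O) := fine (P (past k X (signs o))).
have -> : w = \sum_(o : O | ~~ o ord0)
    G (signs o) * (\sum_(i < r) signs o i.+1) * pr o.
  apply: (has_mean_unique Gw); apply: has_mean_partition.
  - by apply: measurable_funM => //; exact: measurable_walk.
  - by move=> o _; exact: measurable_past.
  - apply: filterS pae => t [s [s0 st us]]; exists s; split => //.
    congr (_ * _); first exact: GE.
    rewrite /walk big_add1/= big_mkord; apply: eq_bigr => i _.
    by apply: st; rewrite /= (leq_trans (ltn_ord i)).
(* The boolean is true when the sign is -1. *)
pose B (q : O * ('I_r * bool)) : set T :=
  past k X (signs q.1) `&` (K @^-1` [set q.2.1.+1]) `&`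
  (e @^-1` [set (-1) ^+ q.2.2]).
have := @has_mean_partition _ _ _ P _ (fun q : O * ('I_r * bool) => ~~ q.1 ord0) B
  (fun q => G (signs q.1) * ((-1) ^+ q.2.2 * signs q.1 q.2.1.+1))
  (fun t => G (X ^~ t) * X k.+1 t).
set s1 := \sum_(q | _) _; set s2 := _ * _.
suff -> : s1 = s2.
  apply.
  - exact: measurable_funM.
  - move=> q _; apply: measurableI; last exact: preimage_singleton_measurable.
    apply: measurableI; first exact: measurable_past.
    exact: preimage_nat_measurable.
  - move: (uniform_upto_ae r0 uK) (sign_law_ae se).
    apply: filterS3 pae => t [s [s0 st us]] /andP[K0 Kr] et.
    have Kr' : ((K t).-1 < r)%N by rewrite prednK.
    pose b := e t == -1.
    have eb : e t = (-1) ^+ b.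
      rewrite /b; case: et => ->; rewrite ?eqxx//.
      by rewrite eq1N1.
    exists (s, (Ordinal Kr', b)); split => //=.
    + by split => //=; split => //=; rewrite prednK.
    + rewrite Xk eb prednK//; congr (_ * (_ * _)); first exact: GE.
      by apply: st; rewrite K0 (leq_trans Kr).
    + move=> [s' [i b']]/= s'0 [[/= /(us _ s'0) -> Ki] /= eb'].
      congr (_, (_, _)); first by apply: val_inj; rewrite /= Ki.
      move: eb'; rewrite eb => /eqP; case: (b) => //; case: (b') => //=.
        by rewrite expr0 expr1 eq_sym eq1N1.
      by rewrite expr0 expr1 eq1N1.
rewrite /s1 /s2 mulr_sumr.
transitivity (\sum_(o : O | ~~ o ord0) \sum_(u : 'I_r * bool)
   G (signs o) * ((-1) ^+ u.2 * signs o u.1.+1) * fine (P (B (o, u)))).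
  by rewrite pair_big/=; apply: eq_big => [q|q _]; rewrite ?andbT//; case: q.
apply: eq_bigr => o _.
transitivity (\sum_(i < r) \sum_(b : bool)
   G (signs o) * ((-1) ^+ b * signs o i.+1) * fine (P (B (o, (i, b))))).
  by rewrite pair_big/=; apply: eq_big => [q|q _]//; case: q.
rewrite mulr_sumr mulr_suml mulr_sumr; apply: eq_bigr => i _.
have PB b : fine (P (B (o, (i, b)))) = pr o * r%:R^-1 * (if b then 1 - p else p).
  rewrite /B ind uK ?ltn_ord// !fineM ?fin_num_measure//.
  - congr (_ * _); case: se => se1 se2; case: b => /=.
      by rewrite expr1 se2.
    by rewrite expr0 se1.
  - exact: measurable_past.
  - by rewrite fin_numM// fin_num_measure//; exact: measurable_past.
rewrite big_bool !PB /= expr0 expr1; ring.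
Qed.

End erw_step_mean.

(** * First and second moments of the walks *)

Section sign_mean.
Context d (T : measurableType d) (R : realType) (P : probability T R).

Lemma has_mean_sign_law p (e : {RV P >-> R}) : sign_law p e ->
  has_mean P e (2 * p - 1).
Proof.
move=> se; have [e1 e2] := se.
have -> : 2 * p - 1 =
    \sum_(b : bool | true) (-1) ^+ b * fine (P (e @^-1` [set (-1) ^+ b])).
  by rewrite big_bool/= expr0 expr1 e1 e2 /=; ring.
apply: has_mean_partition => //.
apply: filterS (sign_law_ae se) => t et.
exists (e t == -1); split => //=; case: et => ->.
- by rewrite eq1N1 expr0.
- by rewrite eqxx expr1.
- by rewrite eq1N1 expr0.
- by rewrite eqxx expr1.
- by move=> [] _; rewrite ?expr0 ?expr1 ?eqxx ?eq1N1// => /eqP; rewrite eq1N1.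
- by move=> [] _; rewrite ?expr0 ?expr1 ?eqxx// => /eqP; rewrite eq_sym eq1N1.
Qed.
End sign_mean.

Section moments.
Context d (T : measurableType d) (R : realType) (P : probability T R).
Variables (p : R) (X : nat -> {RV P >-> R}) (r : nat -> nat) (n : nat).
Hypothesis X1 : sign_law p (X 1).
Hypothesis r_bounds : forall k, (1 <= k < n)%N -> (0 < r k <= k)%N.
Hypothesis XS : forall k, (1 <= k < n)%N -> erw_step p k (r k) X.
Let a := 2 * p - 1.

(** A step is the product of a sign and of an earlier step, except on the null
    sets where the chosen index or the sign is out of range. *)
Lemma step_pm1 j : (1 <= j <= n)%N ->
  {ae P, forall t, X j t = 1 \/ X j t = -1}.
Proof.
elim/ltn_ind: j => -[//|[_ _|k IH /andP[_ kn]]]; first exact: sign_law_ae X1.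
have k1 : (1 <= k.+1 < n)%N by [].
have [K [e [uK se _ Xk]]] := XS k1.
have /andP[r0 rk] := r_bounds k1.
have {}IH : {ae P, forall t, forall j, (1 <= j <= k.+1)%N ->
    X j t = 1 \/ X j t = -1}.
  apply: ae_foralln => j.
  have [jk|_] := boolP (1 <= j <= k.+1)%N; last by apply: aeW => t.
  case/andP: jk => j1 jk.
  apply: filterS (IH j jk _) => //.
  by rewrite j1 (leq_trans jk) ?(ltnW kn).
move: (uniform_upto_ae r0 uK) (sign_law_ae se); apply: filterS3 IH.
move=> t Xt /andP[K0 Kr] et; rewrite Xk.
have := Xt (K t); rewrite K0 (leq_trans Kr rk) => /(_ isT).
by case: et => -> [] ->; rewrite ?mulr1 ?mulrN1 ?opprK ?mul1r; [left|right|right|left].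
Qed.

Lemma has_mean_step_sqr j : (1 <= j <= n)%N -> has_mean P (fun t => X j t ^+ 2) 1.
Proof.
move=> /step_pm1 Xj; apply: (@has_mean_ae _ _ _ _ (cst 1)) (has_mean_cst _ _).
  exact: measurable_funX.
by apply: filterS Xj => t [] ->; rewrite ?sqrrN expr1n.
Qed.

Lemma has_mean_walkS k v w : (1 <= k < n)%N ->
  has_mean P (walk X k) v -> has_mean P (walk X (r k)) w ->
  has_mean P (walk X k.+1) (v + a / (r k)%:R * w).
Proof.
move=> kn kv rw.
have := @erw_step_mean _ _ _ _ _ k (r k) X (fun=> 1) w (r_bounds kn) (XS kn).
move=> /(_ _ (fun _ _ _ => erefl) (measurable_cst _)) h.
apply: (@has_mean_eq _ _ _ _ (fun t => walk X k t + X k.+1 t)).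
  by move=> t; exact: walkS.
apply: has_meanD => //.
apply: (@has_mean_eq _ _ _ _ (fun t => 1 * X k.+1 t)).
  by move=> t; rewrite mul1r.
apply: h.
- move=> j /andP[j1 jk]; apply: step_pm1; rewrite j1 (leq_trans jk)//.
  by case/andP: kn => _ /ltnW.
- by apply: has_mean_eq rw => t; rewrite mul1r.
Qed.

(** [erw_step_mean] with the position at an earlier time as test function. *)
Lemma has_mean_walkMstep j k w : (1 <= k < n)%N -> (j <= k)%N ->
  has_mean P (fun t => walk X j t * walk X (r k) t) w ->
  has_mean P (fun t => walk X j t * X k.+1 t) (a / (r k)%:R * w).
Proof.
move=> kn jk rw.
apply: (@erw_step_mean _ _ _ _ _ k (r k) X
  (fun x => \sum_(1 <= i < j.+1) x i) w (r_bounds kn) (XS kn)) => //.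
- move=> i /andP[i1 ik]; apply: step_pm1; rewrite i1 (leq_trans ik)//.
  by case/andP: kn => _ /ltnW.
- move=> x y xy; apply: eq_big_nat => i /andP[i1 ij]; apply: xy.
  by rewrite i1 (leq_trans _ jk).
- exact: measurable_walk.
Qed.

Lemma has_mean_walkMwalkS j k v w : (1 <= k < n)%N -> (j <= k)%N ->
  has_mean P (fun t => walk X j t * walk X k t) v ->
  has_mean P (fun t => walk X j t * walk X (r k) t) w ->
  has_mean P (fun t => walk X j t * walk X k.+1 t) (v + a / (r k)%:R * w).
Proof.
move=> kn jk jv jw; have h := has_meanD jv (has_mean_walkMstep kn jk jw).
by apply: has_mean_eq h => t; rewrite walkS mulrDr.
Qed.

(** Expand the square: the last term is the mean of X_(k+1)^2 = 1. *)
Lemma has_mean_sqr_walkS k v w : (1 <= k < n)%N ->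
  has_mean P (fun t => walk X k t ^+ 2) v ->
  has_mean P (fun t => walk X k t * walk X (r k) t) w ->
  has_mean P (fun t => walk X k.+1 t ^+ 2) (v + 2 * a / (r k)%:R * w + 1).
Proof.
move=> kn kv kw.
have k1 : (1 <= k.+1 <= n)%N by case/andP: kn.
have h := has_meanD (has_meanD kv
  (has_meanZ 2 (has_mean_walkMstep kn (leqnn k) kw))) (has_mean_step_sqr k1).
rewrite -(mulrA 2) -(mulrA 2 _ w).
by apply: has_mean_eq h => t; rewrite walkS; ring.
Qed.

End moments.

Section restricted_moments.
Context d (T : measurableType d) (R : realType) (P : probability T R).
Variables (p : R) (X : nat -> {RV P >-> R}).
Let a := 2 * p - 1.

Lemma walk1 : walk X 1 = X 1 :> (T -> R).
Proof. by apply/funext => t; rewrite /walk big_nat1. Qed.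

Section full_range.
Variable m : nat.
Hypothesis X1 : sign_law p (X 1).
Hypothesis XS : forall k, (1 <= k < m)%N -> erw_step p k k X.
Let full_bounds k : (1 <= k < m)%N -> (0 < id k <= k)%N.
Proof. by move=> /andP[-> _] /=. Qed.

Lemma has_mean_full_walk k : (1 <= k <= m)%N ->
  has_mean P (walk X k) (a * growth a k).
Proof.
elim: k => // -[_ _|k IH /andP[_ km]].
  by rewrite growth1 mulr1 walk1; exact: has_mean_sign_law.
have {}IH := IH (ltnW km).
have := has_mean_walkS X1 full_bounds XS (k := k.+1) km IH IH.
by congr has_mean; rewrite -/a (growthS a (ltn0Sn k)); ring.
Qed.

Lemma has_mean_full_sqr_walk k : (1 <= k <= m)%N ->
  has_mean P (fun t => walk X k t ^+ 2) (square_moment (2 * a) k).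
Proof.
elim: k => // -[_ /(has_mean_step_sqr X1 full_bounds XS)|k IH /andP[_ km]].
  by rewrite /= mulr0 add0r walk1.
have {}IH := IH (ltnW km).
have IH' : has_mean P (fun t => walk X k.+1 t * walk X k.+1 t) (square_moment (2 * a) k.+1).
  by apply: has_mean_eq IH => t; rewrite expr2.
have := has_mean_sqr_walkS X1 full_bounds XS (k := k.+1) km IH IH'.
rewrite -/a; congr has_mean; rewrite [RHS]/= -/(square_moment _ k.+1); ring.
Qed.

(** Conditionally on the first j steps, the mean position is multiplied by
    1 + a / i at each time i. *)
Lemma has_mean_full_walkMwalk j k : (1 <= j <= k)%N -> (k <= m)%N ->
  has_mean P (fun t => walk X j t * walk X k t)
    (square_moment (2 * a) j * \prod_(j <= i < k) (1 + a / i%:R)).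
Proof.
move=> /andP[j1]; elim: k => [|k IH]; first by case: j j1.
rewrite leq_eqVlt => /predU1P[<- jm|].
  rewrite big_geq// mulr1.
  have := @has_mean_full_sqr_walk j; rewrite j1 => /(_ jm).
  by apply: has_mean_eq => t; rewrite expr2.
rewrite ltnS => jk km.
have k1 : (1 <= k < m)%N by rewrite (leq_trans j1).
have {}IH := IH jk (ltnW km).
have := has_mean_walkMwalkS X1 full_bounds XS k1 jk IH IH.
by congr has_mean; rewrite -/a big_nat_recr//=; ring.
Qed.

End full_range.

Variables m n : nat.
Hypothesis mn : (0 < m <= n)%N.
Hypothesis hX : restricted_erw p m n X.

Let m_bounds k : (1 <= k < n)%N -> (0 < minn k m <= k)%N.
Proof. by case/andP: mn => m0 _ /andP[k0 _]; rewrite leq_min k0 m0 geq_minl. Qed.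

Let m_step k : (1 <= k < n)%N -> erw_step p k (minn k m) X.
Proof.
case: hX => _ h1 h2 /andP[k0 kn]; have [km|mk] := ltnP k m.
  by apply: h1; rewrite k0.
by apply: h2; rewrite mk.
Qed.

Let mean_m := a * growth a m.
Let sqr_m := square_moment (2 * a) m.

Lemma has_mean_restricted_walk_memory : has_mean P (walk X m) mean_m.
Proof.
by case: hX => X1 h1 _; apply: (@has_mean_full_walk m) => //; case/andP: mn => ->/=.
Qed.

Lemma has_mean_restricted_sqr_memory :
  has_mean P (fun t => walk X m t ^+ 2) sqr_m.
Proof.
by case: hX => X1 h1 _; apply: (@has_mean_full_sqr_walk m) => //; case/andP: mn => ->/=.
Qed.

(** Each step after m adds a / m times the mean of S_m. *)
Lemma has_mean_restricted_walk k : (m <= k <= n)%N ->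
  has_mean P (walk X k) (mean_m * (1 + a * (k - m)%:R / m%:R)).
Proof.
case: (hX) => X1 _ _ /andP[mk]; rewrite -(subnK mk).
elim: (k - m)%N => [_|j IH]; rewrite ?addSn.
  rewrite add0n subnn mulr0 mul0r addr0 mulr1.
  exact: has_mean_restricted_walk_memory.
move=> jn; have {}IH := IH (ltnW jn).
have k1 : (1 <= j + m < n)%N by case/andP: mn => m0 _; rewrite addn_gt0 m0 orbT.
have e : minn (j + m) m = m by apply/minn_idPr; exact: leq_addl.
have := has_mean_walkS X1 m_bounds m_step k1 IH.
rewrite e => /(_ _ has_mean_restricted_walk_memory).
by congr has_mean; rewrite -addSn !addnK -(natr1 j) -/a; ring.
Qed.

Lemma has_mean_restricted_walkMmemory k : (m <= k <= n)%N ->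
  has_mean P (fun t => walk X m t * walk X k t)
    (sqr_m * (1 + a * (k - m)%:R / m%:R)).
Proof.
case: (hX) => X1 _ _ /andP[mk]; rewrite -(subnK mk).
have sm : has_mean P (fun t => walk X m t * walk X m t) sqr_m.
  by apply: has_mean_eq has_mean_restricted_sqr_memory => t; rewrite expr2.
elim: (k - m)%N => [_|j IH]; rewrite ?addSn.
  by rewrite add0n subnn mulr0 mul0r addr0 mulr1.
move=> jn; have {}IH := IH (ltnW jn).
have k1 : (1 <= j + m < n)%N by case/andP: mn => m0 _; rewrite addn_gt0 m0 orbT.
have e : minn (j + m) m = m by apply/minn_idPr; exact: leq_addl.
have := has_mean_walkMwalkS X1 m_bounds m_step k1 (leq_addl _ _) IH.
rewrite e => /(_ _ sm).
by congr has_mean; rewrite -addSn !addnK -(natr1 j) -/a; ring.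
Qed.

(** Given the first m steps the later ones are independent signs with mean
    a S_m / m. The first term is the second moment of the conditional mean of
    S_k, the second one is the mean of its conditional variance. *)
Lemma has_mean_restricted_sqr k : (m <= k <= n)%N ->
  has_mean P (fun t => walk X k t ^+ 2)
    (sqr_m * (1 + a * (k - m)%:R / m%:R) ^+ 2 +
     (k - m)%:R * (1 - a ^+ 2 * sqr_m / m%:R ^+ 2)).
Proof.
case: (hX) => X1 _ _ /andP[mk]; rewrite -(subnK mk).
elim: (k - m)%N => [_|j IH]; rewrite ?addSn.
  rewrite add0n subnn mulr0 !mul0r !addr0 expr1n mulr1.
  exact: has_mean_restricted_sqr_memory.
move=> jn; have {}IH := IH (ltnW jn).
have k1 : (1 <= j + m < n)%N by case/andP: mn => m0 _; rewrite addn_gt0 m0 orbT.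
have e : minn (j + m) m = m by apply/minn_idPr; exact: leq_addl.
have sm : has_mean P (fun t => walk X (j + m) t * walk X m t)
    (sqr_m * (1 + a * (j + m - m)%:R / m%:R)).
  have := @has_mean_restricted_walkMmemory (j + m).
  rewrite leq_addl (ltnW jn) => /(_ isT); apply: has_mean_eq => t; exact: mulrC.
have := has_mean_sqr_walkS X1 m_bounds m_step k1 IH.
rewrite e => /(_ _ sm).
congr has_mean; rewrite -addSn !addnK -(natr1 j) -/a.
have : m%:R != 0 :> R by case/andP: mn => m0 _; rewrite pnatr_eq0 -lt0n.
by move: (m%:R) (j%:R) => x y x0; field.
Qed.

End restricted_moments.

(** * The limit of the superdiffusive walk *)

Section cauchy_schwarz.
Context d (T : measurableType d) (R : realType) (P : probability T R).
Implicit Types (f g h : T -> R) (u v w b : R).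

Lemma has_mean_ge0 f v : (forall t, 0 <= f t) -> has_mean P f v -> 0 <= v.
Proof. by move=> f0 [_ fv]; rewrite -lee_fin -fv expectation_ge0. Qed.

(** The discriminant of the nonnegative polynomial x |-> E (f + x g)^2. *)
Lemma has_mean_cauchy_schwarz f g u v w :
  has_mean P (fun t => f t ^+ 2) u -> has_mean P (fun t => g t ^+ 2) v ->
  has_mean P (fun t => f t * g t) w -> w ^+ 2 <= u * v.
Proof.
move=> fu gv fgw.
have q x : 0 <= u + x * w * 2 + x ^+ 2 * v.
  have h := has_meanD (has_meanD fu (has_meanZ (x * 2) fgw)) (has_meanZ (x ^+ 2) gv).
  rewrite (_ : x * w * 2 = x * 2 * w); last by ring.
  apply: has_mean_ge0 (has_mean_eq _ h) => [t|]; first exact: (sqr_ge0 (f t + x * g t)).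
  by move=> t /=; ring.
have v0 : 0 <= v by apply: has_mean_ge0 gv => t; exact: sqr_ge0.
have u0 : 0 <= u by apply: has_mean_ge0 fu => t; exact: sqr_ge0.
have [v_eq0|v_gt0] := eqVneq v 0.
  rewrite v_eq0 mulr0; have [->|w0] := eqVneq w 0; first by rewrite expr0n.
  (* If v = 0 the polynomial is affine; with w <> 0 it would take the value -1
     at this point. *)
  have := q (- (u + 1) / (2 * w)); rewrite v_eq0 mulr0 addr0.
  rewrite (_ : _ / _ * w * 2 = - (u + 1)); last by field.
  by rewrite opprD addrA subrr add0r ler0N1.
have {}v0 : 0 < v by rewrite lt_def v_gt0.
(* The point where the polynomial is minimal. *)
have := q (- w / v).
rewrite (_ : _ + _ + _ = (u * v - w ^+ 2) / v); last by field.
by rewrite pmulr_lge0 ?invr_gt0// subr_ge0.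
Qed.

End cauchy_schwarz.

Section full_limit.
Context d (T : measurableType d) (R : realType) (P : probability T R).
Variables (p : R) (Y : nat -> {RV P >-> R}).
Let a := 2 * p - 1.
Hypothesis a_bounds : 1 / 2 < a < 1.
Hypothesis hY : full_erw p Y.

Let a0 : 0 < a. Proof. by case/andP: a_bounds => + _; apply: lt_trans. Qed.
Let g0 k : 0 < growth a k. Proof. by rewrite growth_gt0// ltW. Qed.

(** Dividing by [growth a k], the factor by which the conditional mean grows,
    makes the position a martingale with constant mean a. *)
Definition martingale k t : R := walk Y k t / growth a k.
Definition martingale_sqr k : R := square_moment (2 * a) k / growth a k ^+ 2.

Lemma measurable_martingale k : measurable_fun setT (martingale k).
Proof. by apply: measurable_funM => //; exact: measurable_walk. Qed.

Lemma has_mean_martingale k : (0 < k)%N -> has_mean P (martingale k) a.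
Proof.
case: hY => Y1 YS k0.
have := @has_mean_full_walk _ _ _ P p Y k Y1 (fun j h => YS j (proj1 (andP h))) k.
rewrite k0 leqnn => /(_ isT)/(has_meanZ (growth a k)^-1).
rewrite -/a mulrCA mulVf ?mulr1 ?gt_eqF//.
by apply: has_mean_eq => t; rewrite /martingale mulrC.
Qed.

(** Orthogonality of martingale increments: E (M_j M_k) = E M_j^2. *)
Lemma has_mean_martingaleM j k : (1 <= j <= k)%N ->
  has_mean P (fun t => martingale j t * martingale k t) (martingale_sqr j).
Proof.
case: hY => Y1 YS jk; have /andP[j1 jk1] := jk.
have := @has_mean_full_walkMwalk _ _ _ P p Y k Y1
  (fun j h => YS j (proj1 (andP h))) j k jk (leqnn k).
rewrite -/a => /(has_meanZ ((growth a j)^-1 * (growth a k)^-1)).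
have gk : growth a k = growth a j * \prod_(j <= i < k) (1 + a / i%:R).
  by rewrite /growth (@big_cat_nat _ _ _ j).
rewrite (_ : _ * _ = martingale_sqr j); last first.
  have := g0 k; have := g0 j; rewrite /martingale_sqr gk.
  move: (growth a j) (\prod_(_ <= _ < _) _) (square_moment _ _) => x y z x0 xy0.
  have y0 : y != 0 by apply: contraTneq xy0 => ->; rewrite mulr0 ltxx.
  by field; rewrite y0 gt_eqF.
by apply: has_mean_eq => t; rewrite /martingale mulrACA mulrC.
Qed.

Lemma has_mean_martingale_sqr k : (0 < k)%N ->
  has_mean P (fun t => martingale k t ^+ 2) (martingale_sqr k).
Proof.
move=> k0; have := @has_mean_martingaleM k k; rewrite k0 leqnn => /(_ isT).
by apply: has_mean_eq => t; rewrite expr2.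
Qed.

Lemma has_mean_martingaleB_sqr j k : (1 <= j <= k)%N ->
  has_mean P (fun t => (martingale j t - martingale k t) ^+ 2) (martingale_sqr k - martingale_sqr j).
Proof.
move=> jk; have /andP[j1 jk1] := jk.
have := has_meanD (has_meanD (has_mean_martingale_sqr j1)
  (has_meanZ (- 2) (has_mean_martingaleM jk))) (has_mean_martingale_sqr (leq_trans j1 jk1)).
rewrite (_ : _ + _ + _ = martingale_sqr k - martingale_sqr j); last by ring.
by apply: has_mean_eq => t; ring.
Qed.

Lemma martingale_sqr_nd j k : (1 <= j <= k)%N -> martingale_sqr j <= martingale_sqr k.
Proof.
move=> /has_mean_martingaleB_sqr/has_mean_ge0; rewrite subr_ge0; apply => t.
exact: sqr_ge0.
Qed.

Lemma is_cvg_martingale_sqr : cvgn martingale_sqr.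
Proof.
have [M hM] : exists M : R, forall n, martingale_sqr n <= M.
  apply: square_moment_growth_bounded; case/andP: a_bounds => -> /ltW ->//.
have : cvgn (fun n => martingale_sqr n.+1).
  apply: nondecreasing_is_cvgn; last by exists M => _ [n _ <-].
  by move=> i j ij; apply: martingale_sqr_nd.
by move=> /cvg_ex[l h]; apply/cvg_ex; exists l; rewrite -cvg_shiftS.
Qed.

Let q := limn martingale_sqr.

Lemma martingale_sqr_le_lim k : (0 < k)%N -> martingale_sqr k <= q.
Proof.
move=> k0; apply: limr_ge; first exact: is_cvg_martingale_sqr.
by near=> n; apply: martingale_sqr_nd; rewrite k0; near: n; exact: nbhs_infty_ge.
Unshelve. all: by end_near. Qed.

Variable M : T -> R.
Hypothesis mM : measurable_fun setT M.
Hypothesis cvgM : {ae P, forall t, (fun k => martingale k t) @ \oo --> M t}.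

(** Lemma of Fatou for the functions (M_j - M_k)^2, as k tends to infinity. *)
Lemma has_mean_limitB_sqr j : (0 < j)%N ->
  exists2 v, v <= q - martingale_sqr j & has_mean P (fun t => (martingale j t - M t) ^+ 2) v.
Proof.
move=> j0.
pose f k t := ((martingale j t - martingale k t) ^+ 2)%:E.
have mf k : measurable_fun setT (f k).
  apply/measurable_EFinP/measurable_funX/measurable_funB; exact: measurable_martingale.
have mD : measurable_fun setT (fun t => (martingale j t - M t) ^+ 2).
  by apply/measurable_funX/measurable_funB => //; exact: measurable_martingale.
have le_q : (\int[P]_t ((martingale j t - M t) ^+ 2)%:E <= (q - martingale_sqr j)%:E)%E.
  have f0 n t : (0 <= f n t)%E by rewrite lee_fin sqr_ge0.
  have := @fatou _ _ _ P setT measurableT f mf (fun n t _ => f0 n t).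
  have -> : limn_einf (fun n => \int[P]_t f n t)%E = (q - martingale_sqr j)%:E.
    apply: (cvg_limn_einf_sup _).1.
    have : (martingale_sqr n - martingale_sqr j)%:E @[n --> \oo] --> (q - martingale_sqr j)%:E.
      apply/cvg_EFin; first exact: nearW.
      by apply: cvgB; [exact: is_cvg_martingale_sqr|exact: cvg_cst].
    apply: cvg_trans; apply: near_eq_cvg; near=> n.
    have /has_mean_martingaleB_sqr[_ <-] : (1 <= j <= n)%N.
      by rewrite j0; near: n; exact: nbhs_infty_ge.
    by rewrite unlock.
  apply: le_trans; rewrite le_eqVlt; apply/orP; left; apply/eqP.
  apply: ae_eq_integral => //; first exact/measurable_EFinP.
    under eq_fun => t do rewrite -[limn_einf _]oppeK -limn_esupN.
    apply: measurableT_comp => //; apply: measurable_fun_limn_esup => k.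
    exact: measurableT_comp.
  apply: filterS cvgM => t ct _; apply/esym; apply: (cvg_limn_einf_sup _).1.
  apply/cvg_EFin; first exact: nearW.
  apply: (@cvg_comp _ _ _ (fun k => martingale j t - martingale k t) (fun x => x ^+ 2)).
    by apply: cvgB; [exact: cvg_cst|exact: ct].
  exact: exprn_continuous.
have fin : (\int[P]_t ((martingale j t - M t) ^+ 2)%:E)%E \is a fin_num.
  rewrite ge0_fin_numE; first by rewrite (le_lt_trans le_q) ?ltry.
  by apply: integral_ge0 => t _; rewrite lee_fin sqr_ge0.
exists (fine (\int[P]_t ((martingale j t - M t) ^+ 2)%:E)%E).
  by rewrite -lee_fin fineK.
split; last by rewrite unlock fineK.
apply/Lfun1_integrable/integrableP; split; first exact/measurable_EFinP.
under eq_integral => t _ do rewrite /= ger0_norm ?sqr_ge0//.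
by rewrite (le_lt_trans le_q) ?ltry.
Unshelve. all: by end_near. Qed.

(** With D = M_j - M and v = E D^2 <= q - E M_j^2, the Cauchy-Schwarz
    inequality bounds the error on the mean, E D, and the error on the second
    moment, E (D (M_j + M)); both bounds vanish as j tends to infinity. *)
Lemma martingale_limit_moments : has_mean P M a /\ has_mean P (fun t => M t ^+ 2) q.
Proof.
have M2 : M \in Lfun P 2%:E.
  have [v _ hv] := has_mean_limitB_sqr (ltn0Sn 0).
  have h1 : martingale 1 \in Lfun P 2%:E.
    by apply: Lfun2_sqr (has_mean_martingale_sqr (ltn0Sn 0)); exact: measurable_martingale.
  have h2 : (fun t => martingale 1 t - M t) \in Lfun P 2%:E.
    by apply: Lfun2_sqr hv; apply: measurable_funB => //; exact: measurable_martingale.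
  rewrite (_ : M = martingale 1 - (fun t => martingale 1 t - M t)); last first.
    by apply/funext => t; rewrite !fctE opprB addrC subrK.
  by rewrite rpredB ?lee1n.
have has_mean_fine f : f \in Lfun P 1 -> has_mean P f (fine ('E_P[f])%E).
  by move=> f1; split; rewrite ?fineK// expectation_fin_num.
have MM : has_mean P M (fine ('E_P[M])%E).
  by apply: has_mean_fine; apply: Lfun_subset12 M2; exact: fin_num_measure.
have MM2 := has_mean_fine _ (Lfun2_mul_Lfun1 M2 M2).
set mu := fine _ in MM; set s := fine _ in MM2.
have {}MM2 : has_mean P (fun t => M t ^+ 2) s.
  by apply: has_mean_eq MM2 => t; rewrite expr2.
(* [mu] and [s] are the moments of M, still unknown. *)
have q0 : (fun j => q - martingale_sqr j) @ \oo --> (0 : R).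
  by rewrite -(subrr q); apply: cvgB; [exact: cvg_cst|exact: is_cvg_martingale_sqr].
have mu_a j : (0 < j)%N -> (a - mu) ^+ 2 <= q - martingale_sqr j.
  move=> j0; have [v vq hv] := has_mean_limitB_sqr j0; apply: le_trans vq.
  have h1 : has_mean P (fun t => (martingale j t - M t) * 1) (a - mu).
    have := has_meanD (has_mean_martingale j0) (has_meanZ (- 1) MM).
    by rewrite mulN1r; apply: has_mean_eq => t; rewrite mulr1 mulN1r.
  have h2 : has_mean P (fun t : T => 1 ^+ 2 : R) 1.
    by rewrite expr1n; exact: has_mean_cst.
  by have := has_mean_cauchy_schwarz hv h2 h1; rewrite mulr1.
have s_q j : (0 < j)%N -> (s - martingale_sqr j) ^+ 2 <= (q - martingale_sqr j) * (2 * s + 2 * q).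
  move=> j0; have [v vq hv] := has_mean_limitB_sqr j0.
  have v0 : 0 <= v by apply: has_mean_ge0 hv => t; exact: sqr_ge0.
  have qj := has_mean_martingale_sqr j0.
  have h1 : has_mean P (fun t => (martingale j t - M t) * (martingale j t + M t)) (martingale_sqr j - s).
    have := has_meanD qj (has_meanZ (- 1) MM2).
    by rewrite mulN1r; apply: has_mean_eq => t; ring.
  have h2 : has_mean P (fun t => (martingale j t + M t) ^+ 2)
      (2 * s + 2 * martingale_sqr j - v).
    have := has_meanD (has_meanD (has_meanZ 2 MM2) (has_meanZ 2 qj)) (has_meanZ (-1) hv).
    by rewrite mulN1r; apply: has_mean_eq => t; ring.
  have w0 : 0 <= 2 * s + 2 * martingale_sqr j - v.
    by apply: has_mean_ge0 h2 => t; exact: sqr_ge0.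
  rewrite -opprB sqrrN.
  apply: (le_trans (has_mean_cauchy_schwarz hv h2 h1)).
  by apply: ler_pM => //; have := martingale_sqr_le_lim j0; lra.
have -> : a = mu.
  apply/eqP; rewrite -subr_eq0 -sqrf_eq0 eq_le sqr_ge0 andbT.
  apply: (@cvgr_to_ge _ \oo _ _ (fun j => q - martingale_sqr j)) => //.
  by near=> j; apply: mu_a; near: j; exact: nbhs_infty_gt.
have -> : q = s.
  apply/esym/eqP; rewrite -subr_eq0 -sqrf_eq0 eq_le sqr_ge0 andbT.
  rewrite -(mul0r (2 * s + 2 * q)).
  apply: (@ler_cvg_to _ \oo _ _ (fun j => (s - martingale_sqr j) ^+ 2)
     (fun j => (q - martingale_sqr j) * (2 * s + 2 * q))).
  - apply: (@cvg_comp _ _ _ (fun k => s - martingale_sqr k) (fun x => x ^+ 2)).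
      by apply: cvgB; [exact: cvg_cst|exact: is_cvg_martingale_sqr].
    exact: exprn_continuous.
  - exact: cvgMr_tmp.
  - by near=> j; apply: s_q; near: j; exact: nbhs_infty_gt.
by split.
Unshelve. all: by end_near. Qed.

End full_limit.

(** * Asymptotics of the walk with restricted memory *)

Section real_limits.
Variable R : realType.
Implicit Types (x y : nat -> R) (u v : nat -> \bar R) (l : R).

Lemma eq_o1_EFin u v x y :
  (\forall n \near \oo, u n = (x n)%:E) -> (\forall n \near \oo, v n = (y n)%:E) ->
  (fun n => x n - y n) @ \oo --> (0 : R) -> eq_o1 u v.
Proof.
move=> ux vy xy; exists (fun n => x n - y n) => //.
by apply: filterS2 ux vy => n -> ->; rewrite -EFinD addrC subrK.
Qed.

Lemma cvg_near_EFin u x l : (\forall n \near \oo, u n = (x n)%:E) ->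
  x @ \oo --> l -> u @ \oo --> l%:E.
Proof.
move=> ux xl; apply/fine_cvgP; split; first by apply: filterS ux => n ->.
by apply: cvg_trans xl; apply: near_eq_cvg; apply: filterS ux => n /= ->.
Qed.

Lemma cvg_exprn x l k : x @ \oo --> l -> (fun n => x n ^+ k) @ \oo --> l ^+ k.
Proof.
move=> xl; apply: (@cvg_comp _ _ _ x (fun y : R => y ^+ k)); first exact: xl.
exact: exprn_continuous.
Qed.

End real_limits.

Section full_erw_limit.
Context d (T : measurableType d) (R : realType) (P : probability T R).
Variables (p : R) (Y : nat -> {RV P >-> R}) (L : {RV P >-> R}) (l : R).
Let a := 2 * p - 1.
Hypothesis a_bounds : 1 / 2 < a < 1.
Hypothesis hY : full_erw p Y.
Hypothesis cvgL : {ae P, forall t,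
  (fun j : nat => walk Y j t / j%:R `^ a) @ \oo --> L t}.
Hypothesis l_gt0 : 0 < l.
Hypothesis cvg_l : (fun n => growth a n / n%:R `^ a) @ \oo --> l.

(** S_k / k^a is the martingale times growth a k / k^a, so L is l times the
    limit of the martingale. *)
Lemma full_erw_limit_moments : 'E_P[L] = (l * a)%:E /\
  'V_P[L] = (l ^+ 2 * (limn (martingale_sqr p) - a ^+ 2))%:E.
Proof.
have mM : measurable_fun setT (fun t => L t / l) by exact: measurable_funM.
have [|M1 M2] := martingale_limit_moments a_bounds hY mM.
  apply: filterS cvgL => t Lt.
  have h : (fun j => walk Y j t / j%:R `^ a * (growth a j / j%:R `^ a)^-1) @ \oo
      --> L t / l.
    by apply: cvgM; [exact: Lt|apply: cvgV => //; exact: lt0r_neq0].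
  apply: cvg_trans h; apply: near_eq_cvg; near=> n.
  have n0 : n%:R `^ a != 0 :> R.
    by rewrite gt_eqF// powR_gt0// ltr0n; near: n; exact: nbhs_infty_gt.
  by rewrite /martingale invf_div mulrA divfK.
have LM : (fun t => L t / l * l) = L.
  by apply/funext => t; rewrite divfK// gt_eqF.
rewrite -LM; split; first by rewrite (expectation_scale _ M1) mulrC.
by rewrite (variance_scale _ mM M1 M2) mulrC.
Unshelve. all: by end_near. Qed.

End full_erw_limit.

Section restricted_asymptotics.
Variables (R : realType) (p alpha : R) (m : nat -> nat).
Variables (d : nat -> measure_display) (T : forall n, measurableType (d n)).
Variables (P : forall n, probability (T n) R).
Variables (X : forall n, nat -> {RV (P n) >-> R}).
Hypothesis hm : forall n : nat, (0 < n)%N -> (0 < m n <= n)%N.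
Hypothesis hm_infty : m @ \oo --> \oo.
Hypothesis hm_ratio : (fun n : nat => (m n)%:R / n%:R : R) @ \oo --> alpha.
Hypothesis hX : forall n : nat, (0 < n)%N -> restricted_erw p (m n) n (X n).
Let a := 2 * p - 1.

Variables (g h : nat -> R).
Hypothesis hg : forall k, (0 < k)%N -> h k = g k / k%:R.

Let rho n : R := (m n)%:R / n%:R.
Let kappa n := a * (1 - rho n) + rho n.
Let kappa_lim := a * (1 - alpha) + alpha.
Let Z n := fun t => walk (X n) n t * g (m n) / n%:R.
Let W n := fun t => walk (X n) (m n) t * h (m n).

Lemma cvg_kappa : kappa @ \oo --> kappa_lim.
Proof.
apply: cvgD; last exact: hm_ratio.
by apply: cvgMl_tmp; apply: cvgB; [exact: cvg_cst|exact: hm_ratio].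
Qed.

Let near_pos : \forall n \near \oo, (0 < n)%N.
Proof. exact: nbhs_infty_gt. Qed.

Lemma expectation_memory n : (0 < n)%N ->
  'E_(P n)[@W n] = (a * growth a (m n) * h (m n))%:E.
Proof.
move=> n0; apply: expectation_scale.
exact: has_mean_restricted_walk_memory (hm n0) (hX n0).
Qed.

Lemma variance_memory n : (0 < n)%N -> 'V_(P n)[@W n] =
  ((square_moment (2 * a) (m n) - (a * growth a (m n)) ^+ 2) * h (m n) ^+ 2)%:E.
Proof.
move=> n0; apply: variance_scale; first exact: measurable_walk.
  exact: has_mean_restricted_walk_memory (hm n0) (hX n0).
exact: has_mean_restricted_sqr_memory (hm n0) (hX n0).
Qed.

Let ZE n : @Z n = fun t => walk (X n) n t * (g (m n) / n%:R).
Proof. by apply/funext => t; rewrite /Z mulrA. Qed.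

Let mR_neq0 n : (0 < n)%N -> (m n)%:R != 0 :> R.
Proof. by move=> /hm/andP[m0 _]; rewrite pnatr_eq0 -lt0n. Qed.

Let nR_neq0 n : (0 < n)%N -> n%:R != 0 :> R.
Proof. by rewrite pnatr_eq0 -lt0n. Qed.

(** The identity E (S_n g / n) = kappa E (S_m g / m), with h = g / m. *)
Lemma expectation_restricted n : (0 < n)%N ->
  'E_(P n)[@Z n] = (a * growth a (m n) * h (m n) * kappa n)%:E.
Proof.
move=> n0; have /andP[m0 mn] := hm n0.
have mnn : (m n <= n <= n)%N by rewrite mn leqnn.
have hmean := has_mean_restricted_walk (hm n0) (hX n0) mnn.
rewrite ZE (expectation_scale _ hmean) hg// natrB// /kappa /rho -/a.
have := mR_neq0 n0; have := nR_neq0 n0.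
by move: (growth _ _) (g _) (_%:R) ((m n)%:R) => x y N M N0 M0; congr EFin; field; rewrite N0 M0.
Qed.

(** The product of g^2 / m and a^2 E S_m^2 / m^2 is written as
    a^2 E (S_m h)^2 / m, which tends to 0 whenever E (S_m h)^2 converges. *)
Lemma variance_restricted n : (0 < n)%N -> 'V_(P n)[@Z n] =
  ((square_moment (2 * a) (m n) - (a * growth a (m n)) ^+ 2) * h (m n) ^+ 2
     * kappa n ^+ 2
   + (g (m n) ^+ 2 / (m n)%:R
      - a ^+ 2 * (square_moment (2 * a) (m n) * h (m n) ^+ 2 * (m n)%:R^-1))
     * (rho n * (1 - rho n)))%:E.
Proof.
move=> n0; have /andP[m0 mn] := hm n0.
have mnn : (m n <= n <= n)%N by rewrite mn leqnn.
have hmean := has_mean_restricted_walk (hm n0) (hX n0) mnn.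
have hsqr := has_mean_restricted_sqr (hm n0) (hX n0) mnn.
rewrite ZE (variance_scale _ (measurable_walk _ _) hmean hsqr) hg// natrB//.
rewrite /kappa /rho -/a.
have := mR_neq0 n0; have := nR_neq0 n0.
move: (growth _ _) (g _) (_%:R) ((m n)%:R) (square_moment _ _) => x y N M s N0 M0.
by congr EFin; field; rewrite N0 M0.
Qed.

Variables (mu nu tau : R).
Hypothesis cvg_mu : (fun k => a * growth a k * h k) @ \oo --> mu.
Hypothesis cvg_nu : (fun k => square_moment (2 * a) k * h k ^+ 2) @ \oo --> nu.
Hypothesis cvg_tau : (fun k => g k ^+ 2 / k%:R) @ \oo --> tau.

Let along (x : nat -> R) (l : R) : x @ \oo --> l -> (fun n => x (m n)) @ \oo --> l.
Proof. exact: cvg_comp. Qed.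

Lemma cvg_expectation_restricted :
  (fun n => 'E_(P n)[@Z n]) @ \oo --> (mu * kappa_lim)%:E.
Proof.
apply: cvg_near_EFin; first by apply: filterS near_pos => n; exact: expectation_restricted.
by apply: cvgM; [exact: (along cvg_mu)|exact: cvg_kappa].
Qed.

Lemma expectation_restricted_o1 :
  eq_o1 (fun n => 'E_(P n)[@Z n]) (fun n => 'E_(P n)[@W n] * kappa_lim%:E)%E.
Proof.
apply: eq_o1_EFin.
- by apply: filterS near_pos => n; exact: expectation_restricted.
- apply: filterS near_pos => n n0; rewrite expectation_memory// -EFinM; reflexivity.
- rewrite -(subrr (mu * kappa_lim)); apply: cvgB.
    by apply: cvgM; [exact: (along cvg_mu)|exact: cvg_kappa].
  by apply: cvgMr_tmp; exact: (along cvg_mu).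
Qed.

(** Relative form of the asymptotics of the mean: the error is exactly
    kappa - kappa_lim, by [expectation_restricted]. *)
Lemma expectation_restricted_factor :
  exists2 r : nat -> R, r @ \oo --> (0 : R) &
    \forall n \near \oo,
      'E_(P n)[@Z n] = ('E_(P n)[@W n] * (kappa_lim + r n)%:E)%E.
Proof.
exists (fun n => kappa n - kappa_lim).
  by rewrite -(subrr kappa_lim); apply: cvgB; [exact: cvg_kappa|exact: cvg_cst].
apply: filterS near_pos => n n0.
by rewrite expectation_restricted// expectation_memory// -EFinM [_ + (_ - _)]addrC subrK.
Qed.

Let var_memory_lim : (fun k => (square_moment (2 * a) k - (a * growth a k) ^+ 2) * h k ^+ 2)
  @ \oo --> nu - mu ^+ 2.
Proof.
under eq_fun do rewrite mulrBl -exprMn.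
by apply: cvgB => //; exact: cvg_exprn.
Qed.

Let var_lim := (nu - mu ^+ 2) * kappa_lim ^+ 2 + tau * (alpha * (1 - alpha)).

Let cvg_var_formula : (fun n =>
  (square_moment (2 * a) (m n) - (a * growth a (m n)) ^+ 2) * h (m n) ^+ 2
     * kappa n ^+ 2
   + (g (m n) ^+ 2 / (m n)%:R
      - a ^+ 2 * (square_moment (2 * a) (m n) * h (m n) ^+ 2 * (m n)%:R^-1))
     * (rho n * (1 - rho n))) @ \oo --> var_lim.
Proof.
apply: cvgD.
  by apply: cvgM; [exact: (along var_memory_lim)|exact: cvg_exprn cvg_kappa].
apply: cvgM; last first.
  by apply: cvgM => //; apply: cvgB; [exact: cvg_cst|exact: hm_ratio].
rewrite -[X in _ --> X]subr0; apply: cvgB; first exact: (along cvg_tau).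
rewrite -(mulr0 (a ^+ 2)); apply: cvgMl_tmp; rewrite -(mulr0 nu).
by apply: cvgM; [exact: (along cvg_nu)|exact: (along (@cvg_invn R))].
Qed.

Lemma cvg_variance_restricted : (fun n => 'V_(P n)[@Z n]) @ \oo --> var_lim%:E.
Proof.
apply: cvg_near_EFin; last exact: cvg_var_formula.
by apply: filterS near_pos => n; exact: variance_restricted.
Qed.

Lemma variance_restricted_o1 l : l = var_lim ->
  eq_o1 (fun n => 'V_(P n)[@Z n]) (fun=> l%:E).
Proof.
move=> ->; apply: (@eq_o1_EFin _ _ _ _ (fun=> var_lim)).
- by apply: filterS near_pos => n; exact: variance_restricted.
- exact: nearW.
- by rewrite -(subrr var_lim); apply: cvgB; [exact: cvg_var_formula|exact: cvg_cst].
Qed.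

(** The constant l stands for var_lim divided by the limit variance of
    S_m h; it is introduced by an equation to avoid that division. *)
Lemma variance_restricted_memory_o1 l : (nu - mu ^+ 2) * l = var_lim ->
  eq_o1 (fun n => 'V_(P n)[@Z n]) (fun n => 'V_(P n)[@W n] * l%:E)%E.
Proof.
move=> lE; apply: eq_o1_EFin.
- by apply: filterS near_pos => n; exact: variance_restricted.
- by apply: filterS near_pos => n n0; rewrite variance_memory// -EFinM; reflexivity.
- rewrite -(subrr var_lim) -{2}lE; apply: cvgB; first exact: cvg_var_formula.
  by apply: cvgMr_tmp; exact: (along var_memory_lim).
Qed.

End restricted_asymptotics.

(** For p = 1/2 the steps are uncorrelated and symmetric, and the variance is
    exactly n. *)
Lemma variance_symmetric d (T : measurableType d) (R : realType)
    (P : probability T R) (p : R) (m n : nat) (X : nat -> {RV P >-> R}) :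
  p = 1 / 2 -> (0 < m <= n)%N -> restricted_erw p m n X ->
  'V_P[fun t => walk X n t / Num.sqrt n%:R] = 1%:E.
Proof.
move=> pE /[dup] mn /andP[m0 mn'] hX.
have mnn : (m <= n <= n)%N by rewrite mn' leqnn.
have a0 : 2 * p - 1 = 0 by rewrite pE; field.
have hmean := has_mean_restricted_walk mn hX mnn.
have hsqr := has_mean_restricted_sqr mn hX mnn.
rewrite (variance_scale _ (measurable_walk _ _) hmean hsqr) a0.
have z1 : 0 != 1 :> R by rewrite eq_sym oner_neq0.
rewrite mulr0 (square_moment_neq1 z1 m0) exprVn sqr_sqrtr ?ler0n//.
have nR : n%:R != 0 :> R by rewrite pnatr_eq0 -lt0n (leq_trans m0).
rewrite natrB// !(mul0r, mulr0, subr0, addr0, expr0n, expr1n, divr1, mulr1)/=.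
by rewrite addrC subrK divff.
Qed.

(** * The diffusive, critical and superdiffusive normalizations *)

Section normalizations.
Variable R : realType.
Implicit Types a p : R.

Lemma invr_sqrt_natr k : (0 < k)%N -> (Num.sqrt k%:R)^-1 = Num.sqrt k%:R / k%:R :> R.
Proof.
move=> k0; rewrite -{3}(sqr_sqrtr (ler0n R k)) expr2 invfM mulrA divff ?mul1r//.
by rewrite gt_eqF// sqrtr_gt0 ltr0n.
Qed.

Lemma cvg_diffusive_mean a : - 1 <= a < 1 / 2 ->
  (fun k => a * growth a k * (Num.sqrt k%:R)^-1) @ \oo --> (0 : R).
Proof.
move=> /andP[a1 a2]; under eq_fun do rewrite -mulrA -powR12_sqrt//.
rewrite -(mulr0 a); apply: cvgMl_tmp; apply: cvg_growth_powR0; lra.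
Qed.

Lemma cvg_diffusive_sqr a : - 1 <= a < 1 / 2 ->
  (fun k => square_moment (2 * a) k * (Num.sqrt k%:R)^-1 ^+ 2) @ \oo --> ((1 - 2 * a)^-1 : R).
Proof.
move=> /andP[a1 a2]; under eq_fun do rewrite exprVn sqr_sqrtr//.
by apply: cvg_square_moment_lt1; lra.
Qed.

Lemma cvg_diffusive_tau : (fun k => Num.sqrt k%:R ^+ 2 / k%:R) @ \oo --> (1 : R).
Proof.
apply: cvg_near_cst; near=> k; rewrite sqr_sqrtr// divff// pnatr_eq0 -lt0n.
by near: k; exact: nbhs_infty_gt.
Unshelve. all: by end_near. Qed.

Lemma invr_sqrt_natr_ln k : (0 < k)%N -> (Num.sqrt (k%:R * ln k%:R))^-1 =
  Num.sqrt (k%:R / ln k%:R) / k%:R :> R.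
Proof.
move=> k0; rewrite !sqrtrM// invfM sqrtrV ?ln_ge0 ?ler1n// invr_sqrt_natr//.
by rewrite mulrAC.
Qed.

(** The mean itself is of order sqrt k, so the factor 1 / sqrt (ln k) decides. *)
Lemma cvg_critical_mean a : a = 1 / 2 ->
  (fun k => a * growth a k * (Num.sqrt (k%:R * ln k%:R))^-1) @ \oo --> (0 : R).
Proof.
move=> aE; have a01 : 0 < a <= 1 by rewrite aE; lra.
have [l l0 cl] := cvg_growth_div_powR a01.
have s0 : (fun k => Num.sqrt (ln k%:R)^-1) @ \oo --> (0 : R).
  by rewrite -(sqrtr0 R); apply: cvg_comp (@cvg_ln_inv R) _; exact: sqrt_continuous.
have h : (fun k => a * (growth a k / k%:R `^ a * Num.sqrt (ln k%:R)^-1)) @ \oo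
    --> (a * (l * 0) : R).
  by apply: cvgMl_tmp; apply: cvgM; [exact: cl|exact: s0].
rewrite !mulr0 in h; apply: cvg_trans h; apply: near_eq_cvg; near=> k.
have ln0 : 0 <= ln k%:R :> R.
  by rewrite ln_ge0// ler1n; near: k; exact: nbhs_infty_gt.
rewrite sqrtrM// invfM -[Num.sqrt k%:R]powR12_sqrt// sqrtrV// -[2^-1]mul1r -aE.
by rewrite !mulrA.
Unshelve. all: by end_near. Qed.

Lemma cvg_critical_sqr a : a = 1 / 2 ->
  (fun k => square_moment (2 * a) k * (Num.sqrt (k%:R * ln k%:R))^-1 ^+ 2) @ \oo --> (1 : R).
Proof.
move=> ->; rewrite (_ : 2 * (1 / 2) = 1); last by field.
apply: cvg_trans (@cvg_square_moment_1 R); apply: near_eq_cvg; near=> k.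
rewrite exprVn sqr_sqrtr// mulr_ge0// ln_ge0// ler1n.
by near: k; exact: nbhs_infty_gt.
Unshelve. all: by end_near. Qed.

Lemma cvg_critical_tau :
  (fun k => Num.sqrt (k%:R / ln k%:R) ^+ 2 / k%:R) @ \oo --> (0 : R).
Proof.
apply: cvg_trans (@cvg_ln_inv R); apply: near_eq_cvg; near=> k.
have k0 : (0 < k)%N by near: k; exact: nbhs_infty_gt.
rewrite sqr_sqrtr; last by rewrite divr_ge0// ln_ge0// ler1n.
by rewrite mulrAC divff ?mul1r// pnatr_eq0 -lt0n.
Unshelve. all: by end_near. Qed.

Lemma invr_powR_natr p k : (0 < k)%N ->
  (k%:R `^ (2 * p - 1))^-1 = k%:R `^ (2 * (1 - p)) / k%:R :> R.
Proof.
move=> k0; have kR : k%:R != 0 :> R by rewrite pnatr_eq0 -lt0n.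
rewrite -powRN -{3}(@powRr1 R k%:R)// -powRB ?kR ?implybT//; congr (_ `^ _); ring.
Qed.

Lemma cvg_superdiffusive_mean a (l : R) : (fun n => growth a n / n%:R `^ a) @ \oo --> l ->
  (fun k => a * growth a k * (k%:R `^ a)^-1) @ \oo --> l * a.
Proof.
move=> cl; rewrite mulrC; under eq_fun do rewrite -mulrA.
exact: cvgMl_tmp.
Qed.

(** S_k / k^a is the martingale times growth a k / k^a, a factor that tends to
    l. *)
Lemma cvg_superdiffusive_sqr p (l : R) : 1 / 2 < 2 * p - 1 < 1 ->
  (fun n => growth (2 * p - 1) n / n%:R `^ (2 * p - 1)) @ \oo --> l ->
  cvgn (martingale_sqr p) ->
  (fun k => square_moment (2 * (2 * p - 1)) k * (k%:R `^ (2 * p - 1))^-1 ^+ 2) @ \oo -->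
    l ^+ 2 * limn (martingale_sqr p).
Proof.
move=> pb cl cq; rewrite [X in _ --> X]mulrC.
have h : (fun k => martingale_sqr p k * (growth (2 * p - 1) k / k%:R `^ (2 * p - 1)) ^+ 2)
    @ \oo --> limn (martingale_sqr p) * l ^+ 2.
  by apply: cvgM; [exact: cq|exact: cvg_exprn].
apply: cvg_trans h; apply: near_eq_cvg; apply: nearW => k; rewrite /martingale_sqr exprMn.
rewrite mulrA divfK// sqrf_eq0 gt_eqF// growth_gt0//; lra.
Qed.

Lemma cvg_superdiffusive_tau p : 3 / 4 < p ->
  (fun k => (k%:R `^ (2 * (1 - p))) ^+ 2 / k%:R) @ \oo --> (0 : R).
Proof.
move=> hp; have p1 : 0 < 4 * p - 3 by lra.
apply: cvg_trans (@cvg_natr_powRN R _ p1); apply: near_eq_cvg; near=> k.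
have kR : k%:R != 0 :> R.
  by rewrite pnatr_eq0 -lt0n; near: k; exact: nbhs_infty_gt.
rewrite -powR_mulrn ?powR_ge0// -powRrM -{3}(@powRr1 R k%:R)// -powRB ?kR ?implybT//.
congr (_ `^ _); ring.
Unshelve. all: by end_near. Qed.

End normalizations.

Theorem proposition6p1 (R : realType) (p alpha : R) (m : nat -> nat)
    (d : nat -> measure_display) (T : forall n : nat, measurableType (d n))
    (P : forall n : nat, probability (T n) R)
    (X : forall n : nat, nat -> {RV (P n) >-> R})
    (hp : 0 < p < 1) (halpha : 0 < alpha <= 1)
    (hm : forall n : nat, (0 < n)%N -> (0 < m n <= n)%N)
    (hm_infty : m @ \oo --> \oo)
    (hm_ratio : (fun n : nat => (m n)%:R / n%:R : R) @ \oo --> alpha)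
    (hX : forall n : nat, (0 < n)%N -> restricted_erw p (m n) n (X n)) :
  (* (a) *)
  (p < 3 / 4 ->
    let Z n := fun t => walk (X n) n t * Num.sqrt (m n)%:R / n%:R in
    let W n := fun t => walk (X n) (m n) t / Num.sqrt (m n)%:R in
    [/\ eq_o1 (fun n => 'E_(P n)[Z n])
          (fun n => 'E_(P n)[W n]
             * (2 * p - 1 + 2 * alpha * (1 - p))%:E)%E,
        (fun n => 'E_(P n)[Z n]) @ \oo --> 0%:E,
        eq_o1 (fun n => 'V_(P n)[Z n])
          (fun=> (1 / (3 - 4 * p)
             * ((2 * p - 1) ^+ 2 * (1 - alpha) ^+ 2
                + 2 * (2 * p - 1) * alpha * (1 - alpha) + alpha ^+ 2)
             + alpha * (1 - alpha))%:E),
        eq_o1 (fun n => 'V_(P n)[Z n])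
          (fun=> (1 / (3 - 4 * p) * ((2 * p - 1) * (1 - alpha) + alpha) ^+ 2
             + alpha * (1 - alpha))%:E) &
        p = 1 / 2 ->
          (fun n => 'V_(P n)[Z n]) @ \oo --> alpha%:E /\
          (fun n => 'V_(P n)[fun t => walk (X n) n t / Num.sqrt n%:R]) @ \oo
            --> 1%:E])
  /\ (* (b) *)
  (p = 3 / 4 ->
    let Z n := fun t =>
      walk (X n) n t * Num.sqrt ((m n)%:R / ln (m n)%:R) / n%:R in
    let W n := fun t =>
      walk (X n) (m n) t / Num.sqrt ((m n)%:R * ln (m n)%:R) in
    [/\ eq_o1 (fun n => 'E_(P n)[Z n])
          (fun n => 'E_(P n)[W n] * ((1 + alpha) / 2)%:E)%E,
        (fun n => 'E_(P n)[Z n]) @ \oo --> 0%:E,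
        eq_o1 (fun n => 'V_(P n)[Z n])
          (fun n => 'V_(P n)[W n]
             * (1 / 4 * (1 - alpha) ^+ 2 + alpha)%:E)%E &
        eq_o1 (fun n => 'V_(P n)[Z n])
          (fun=> (1 / 4 * (1 - alpha) ^+ 2 + alpha)%:E)])
  /\ (* (c). Two misprints of the source are corrected in the mean: S_m is
        normalized by m^(2p-1), not by m^(2(1-p)), and the limit is
        E(L) (2p-1 + 2 alpha (1-p)), which is positive, not 0. *)
  (3 / 4 < p ->
    let Z n := fun t =>
      walk (X n) n t * (m n)%:R `^ (2 * (1 - p)) / n%:R in
    let W n := fun t => walk (X n) (m n) t / (m n)%:R `^ (2 * p - 1) in
    (exists2 r : nat -> R, r @ \oo --> (0 : R) &
      \forall n \near \oo, 'E_(P n)[Z n] =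
        ('E_(P n)[W n] * (2 * p - 1 + 2 * alpha * (1 - p) + r n)%:E)%E) /\
    forall (d' : measure_display) (T' : measurableType d')
      (P' : probability T' R) (Y : nat -> {RV P' >-> R}) (L : {RV P' >-> R}),
      full_erw p Y ->
      {ae P', forall t,
        (fun j : nat => walk Y j t / j%:R `^ (2 * p - 1)) @ \oo --> L t} ->
      [/\ (fun n => 'E_(P n)[Z n]) @ \oo -->
            ('E_P'[L] * (2 * p - 1 + 2 * alpha * (1 - p))%:E)%E,
          eq_o1 (fun n => 'V_(P n)[Z n])
            (fun=> 'V_P'[L]
               * ((2 * p - 1) ^+ 2 * (1 - alpha) ^+ 2
                  + 2 * (2 * p - 1) * alpha * (1 - alpha) + alpha ^+ 2)%:E)%E &
          eq_o1 (fun n => 'V_(P n)[Z n])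
            (fun=> 'V_P'[L]
               * (((2 * p - 1) * (1 - alpha) + alpha) ^+ 2)%:E)%E]).
Proof.
have /andP[p0 p1] := hp.
have kE : 2 * p - 1 + 2 * alpha * (1 - p) = (2 * p - 1) * (1 - alpha) + alpha by ring.
have sqrE : (2 * p - 1) ^+ 2 * (1 - alpha) ^+ 2
    + 2 * (2 * p - 1) * alpha * (1 - alpha) + alpha ^+ 2
    = ((2 * p - 1) * (1 - alpha) + alpha) ^+ 2 by ring.
split; last split.
- move=> p34 Z W.
  have ab : - 1 <= 2 * p - 1 < 1 / 2 by lra.
  have c1 := cvg_diffusive_mean ab.
  have c2 := cvg_diffusive_sqr ab.
  have c3 := @cvg_diffusive_tau R.
  have h := @invr_sqrt_natr R.
  have qE : 1 - 2 * (2 * p - 1) = 3 - 4 * p by ring.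
  have V := variance_restricted_o1 hm hm_infty hm_ratio hX h c1 c2 c3.
  split.
  + rewrite kE; exact: (expectation_restricted_o1 hm hm_infty hm_ratio hX h c1).
  + have := cvg_expectation_restricted hm hm_infty hm_ratio hX h c1.
    by rewrite mul0r.
  + apply: V; rewrite sqrE qE; ring.
  + apply: V; rewrite qE; ring.
  + move=> pE; split.
      have := cvg_variance_restricted hm hm_infty hm_ratio hX h c1 c2 c3.
      rewrite (_ : _ * _ + _ * _ = alpha)//.
      have -> : 2 * p - 1 = 0 by rewrite pE; field.
      rewrite mulr0 subr0 invr1; ring.
    apply: cvg_near_cst; near=> n.
    have n0 : (0 < n)%N by near: n; exact: nbhs_infty_gt.
    exact: (variance_symmetric pE (hm _ n0) (hX _ n0)).
- move=> pE Z W.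
  have aE : 2 * p - 1 = 1 / 2 by rewrite pE; field.
  have c1 := cvg_critical_mean aE.
  have c2 := cvg_critical_sqr aE.
  have c3 := @cvg_critical_tau R.
  have h := @invr_sqrt_natr_ln R.
  have kE' : (1 + alpha) / 2 = (2 * p - 1) * (1 - alpha) + alpha.
    by rewrite aE; field.
  split.
  + rewrite kE'; exact: (expectation_restricted_o1 hm hm_infty hm_ratio hX h c1).
  + have := cvg_expectation_restricted hm hm_infty hm_ratio hX h c1.
    by rewrite mul0r.
  + apply: (variance_restricted_memory_o1 hm hm_infty hm_ratio hX h c1 c2 c3).
    by rewrite aE; field.
  + apply: (variance_restricted_o1 hm hm_infty hm_ratio hX h c1 c2 c3).
    by rewrite aE; field.
- move=> p34 Z W.
  have ab : 1 / 2 < 2 * p - 1 < 1 by lra.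
  have ab' : 0 < 2 * p - 1 <= 1 by lra.
  have [l l0 cl] := cvg_growth_div_powR ab'.
  have c1 := cvg_superdiffusive_mean cl.
  have c3 := cvg_superdiffusive_tau p34.
  have h := @invr_powR_natr R p.
  split; first by rewrite kE; exact: (expectation_restricted_factor hm hm_ratio hX h).
  move=> d' T' P' Y L hY cL.
  have [EL VL] := full_erw_limit_moments ab hY cL l0 cl.
  have c2 := cvg_superdiffusive_sqr ab cl (is_cvg_martingale_sqr ab hY).
  have V := variance_restricted_o1 hm hm_infty hm_ratio hX h c1 c2 c3.
  split.
  + rewrite EL kE -EFinM.
    exact: (cvg_expectation_restricted hm hm_infty hm_ratio hX h c1).
  + by rewrite VL sqrE -EFinM; apply: V; ring.
  + by rewrite VL -EFinM; apply: V; ring.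
Unshelve. all: by end_near. Qed.
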